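(* The decision problem \textsc{Optimal Exchanges}, restricted to instances with identical binary utilities (the number of agents being part of the input), is in P.
   Context: Let $N=\{1,\dots,n\}$ be a set of $n\ge 2$ agents and $M$ a set of $m\ge 1$ indivisible goods. Each agent $i$ has an additive utility function $u_i:2^M\to\mathbb{R}_{\ge 0}$, i.e., $u_i(M')=\sum_{g\in M'}u_i(\{g\})$. An instance consists of $N$, $M$ and $(u_i)_{i\in N}$. Utilities are identical if $u_i=u_j$ for all $i,j\in N$, and binary if $u_i(\{g\})\in\{0,1\}$ for all $i\in N$, $g\in M$. An allocation $\mathcal{A}=(A_1,\dots,A_n)$ is an ordered partition of $M$ into $n$ (possibly empty) bundles, $A_i$ going to agent $i$. Agent $i$ is EF1 towards agent $j$ in $\mathcal{A}$ if $A_j=\varnothing$ or there exists $g\in A_j$ with $u_i(A_i)\ge u_i(A_j\setminus\{g\})$. $\mathcal{A}$ is EF1 if every agent is EF1 towards every other agent. An exchange transforms an allocation $\mathcal{A}$ into an allocation $\mathcal{B}$ where, for some distinct $i,j\in N$, $g\in A_i$, $g'\in A_j$, we have $B_i=(A_i\cup\{g'\})\setminus\{g\}$, $B_j=(A_j\cup\{g\})\setminus\{g'\}$, and $B_k=A_k$ for $k\ne i,j$. The optimal number of exchanges required to reach an EF1 allocation from $\mathcal{A}$ is the smallest $T\ge 0$ such that some sequence of $T$ exchanges starting at $\mathcal{A}$ ends in an EF1 allocation ($\infty$ if none exists). \textsc{Optimal Exchanges}: given an instance (utilities listed good by good for each agent), an initial allocation $\mathcal{A}$, and a number $k$, decide whether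 the optimal number of exchanges required to reach an EF1 allocation from $\mathcal{A}$ is at most $k$. *)

(* Defs.v *)
From HB Require Import structures.
From mathcomp Require Import all_boot all_order all_algebra.

Set Implicit Arguments.
Unset Strict Implicit.
Unset Printing Implicit Defensive.

Import Order.TTheory GRing.Theory Num.Theory.
Local Open Scope ring_scope.

(** * Fair division *)

Record instance (R : realDomainType) := Instance {
  agents : nat;
  goods : nat;
  agents_ge2 : (2 <= agents)%N;
  goods_ge1 : (1 <= goods)%N;
  utility : 'I_agents -> {set 'I_goods} -> R;
  utility_ge0 : forall i S, 0 <= utility i S;
  utility_additive :
    forall i S, utility i S = \sum_(g in S) utility i [set g] }.

Arguments utility {R} _ _ _.

Definition identical_utilities (R : realDomainType) (I : instance R) : Prop :=
  forall i j, utility I i =1 utility I j.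

Definition binary_utilities (R : realDomainType) (I : instance R) : Prop :=
  forall i g, utility I i [set g] = 0 \/ utility I i [set g] = 1.

(* Bundles may be empty, so [finset.partition] does not apply. *)
Definition is_allocation (n m : nat) (A : {ffun 'I_n -> {set 'I_m}}) : bool :=
  [forall i, forall j, (i != j) ==> [disjoint A i & A j]]
  && (\bigcup_i A i == [set: 'I_m]).

Definition allocation (n m : nat) : Type :=
  {A : {ffun 'I_n -> {set 'I_m}} | is_allocation A}.

Definition bundle (n m : nat) (A : allocation n m) (i : 'I_n) : {set 'I_m} :=
  val A i.

Definition EF1_towards (R : realDomainType) (I : instance R)
    (A : allocation (agents I) (goods I)) (i j : 'I_(agents I)) : bool :=
  (bundle A j == set0)
  || [exists g in bundle A j,
        utility I i (bundle A j :\ g) <= utility I i (bundle A i)].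

Definition EF1 (R : realDomainType) (I : instance R)
    (A : allocation (agents I) (goods I)) : bool :=
  [forall i, forall j, (j != i) ==> EF1_towards A i j].

Definition exchange (n m : nat) : rel (allocation n m) := fun A B =>
  [exists i, exists j, exists g, exists g',
    [&& i != j, g \in bundle A i, g' \in bundle A j,
        bundle B i == (bundle A i :|: [set g']) :\ g,
        bundle B j == (bundle A j :|: [set g]) :\ g'
      & [forall k, (k != i) && (k != j) ==> (bundle B k == bundle A k)]]].

Definition EF1_after (R : realDomainType) (I : instance R)
    (A : allocation (agents I) (goods I)) (T : nat) : Prop :=
  exists s : seq (allocation (agents I) (goods I)),
    [/\ size s = T, path (@exchange _ _) A s & EF1 (last A s)].

(* The optimal number of exchanges, [None] standing for infinity. *)
Definition is_optimal_number (R : realDomainType) (I : instance R)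
    (A : allocation (agents I) (goods I)) (o : option nat) : Prop :=
  if o is Some T then
    EF1_after A T /\ forall T', EF1_after A T' -> (T <= T')%N
  else forall T, ~ EF1_after A T.

(** * Deterministic multi-tape Turing machines and the class P *)

Inductive move := MoveLeft | Stay | MoveRight.

(* A two-way infinite tape: the cells on either side of the head are listed
   starting from the one nearest to it, and all unlisted cells hold [blank]. *)
Record tape (C : Type) := Tape {
  left_cells : seq C;
  scanned : C;
  right_cells : seq C }.

Definition move_head (C : Type) (blank : C) (d : move) (t : tape C) : tape C :=
  let: Tape l c r := t in
  match d with
  | MoveLeft => Tape (behead l) (head blank l) (c :: r)
  | Stay => t
  | MoveRight => Tape (c :: l) (head blank r) (behead r)
  end.

Definition write (C : Type) (c : C) (t : tape C) : tape C :=
  Tape (left_cells t) c (right_cells t).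

Definition tape_of_word (C : Type) (blank : C) (w : seq C) : tape C :=
  Tape [::] (head blank w) (behead w).

(* A cell is blank ([None]), an input symbol, or an auxiliary symbol. *)
Definition cell (Sigma aux : finType) : finType := option (Sigma + aux).

(* Tape 0 is the input tape; it is also writable. *)
Record machine (Sigma : finType) := Machine {
  work_tapes : nat;
  aux : finType;
  state : finType;
  start : state;
  verdict : state -> option bool;
  delta : state -> {ffun 'I_work_tapes.+1 -> cell Sigma aux} ->
          state * {ffun 'I_work_tapes.+1 -> cell Sigma aux * move} }.

Record config (Sigma : finType) (M : machine Sigma) := Config {
  current : state M;
  tapes : {ffun 'I_(work_tapes M).+1 -> tape (cell Sigma (aux M))} }.

Definition init_config (Sigma : finType) (M : machine Sigma) (w : seq Sigma) :
    config M :=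
  Config (start M)
    [ffun i => tape_of_word None
       (if i == ord0 then [seq Some (inl a) | a <- w] else [::])].

(* The halting states are those with a verdict. *)
Definition step (Sigma : finType) (M : machine Sigma) (c : config M) :
    config M :=
  if verdict (current c) is Some _ then c else
  let: (q, act) := delta (current c) [ffun i => scanned (tapes c i)] in
  Config q
    [ffun i => move_head None (act i).2 (write (act i).1 (tapes c i))].

Definition outcome (Sigma : finType) (M : machine Sigma) (w : seq Sigma)
    (t : nat) : option bool :=
  verdict (current (iter t (@step Sigma M) (init_config M w))).

Definition decides_in_time (Sigma : finType) (M : machine Sigma)
    (L : seq Sigma -> Prop) (f : nat -> nat) : Prop :=
  forall w, exists b : bool,
    outcome M w (f (size w)) = Some b /\ (b = true <-> L w).

Definition in_P (Sigma : finType) (L : seq Sigma -> Prop) : Prop :=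
  exists (M : machine Sigma) (c d : nat),
    decides_in_time M L (fun n => c * n ^ d + c)%N.

(** * Decision problems as languages *)

Record decision_problem (Sigma : finType) := DecisionProblem {
  input : Type;
  encode : input -> seq Sigma;
  yes : input -> Prop }.

Definition restrict (Sigma : finType) (D : decision_problem Sigma)
    (Q : input D -> Prop) : decision_problem Sigma :=
  @DecisionProblem Sigma {x : input D | Q x}
    (fun x => encode (sval x)) (fun x => yes (sval x)).

Definition language (Sigma : finType) (D : decision_problem Sigma)
    (w : seq Sigma) : Prop :=
  exists x : input D, w = encode x /\ yes x.

(** * Optimal Exchanges *)

Inductive symbol := Bit of bool | Slash | Comma | Semicolon | Hash.

Definition symbol_code (a : symbol) : option (option (option (option bool))) :=
  match a with
  | Slash => None
  | Comma => Some None
  | Semicolon => Some (Some None)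
  | Hash => Some (Some (Some None))
  | Bit b => Some (Some (Some (Some b)))
  end.

Definition symbol_decode (c : option (option (option (option bool)))) :
    symbol :=
  match c with
  | None => Slash
  | Some None => Comma
  | Some (Some None) => Semicolon
  | Some (Some (Some None)) => Hash
  | Some (Some (Some (Some b))) => Bit b
  end.

Lemma symbol_codeK : cancel symbol_code symbol_decode.
Proof. by case. Qed.

HB.instance Definition _ := Countable.copy symbol (can_type symbol_codeK).
HB.instance Definition _ : isFinite symbol := CanIsFinite symbol_codeK.

(* Binary, least significant digit first, without superfluous zeros; the
   numeral of 0 is the single digit 0. *)
Definition encode_nat (n : nat) : seq symbol :=
  [seq Bit (odd (n %/ 2 ^ i)) | i <- iota 0 (trunc_log 2 n).+1].

(* Used for nonnegative rationals only, hence no sign. *)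
Definition encode_rat (q : rat) : seq symbol :=
  encode_nat `|numq q|%N ++ Slash :: encode_nat `|denq q|%N.

(* The input has to be a finite word, so utilities are taken in [rat]. *)
Record exchange_input := ExchangeInput {
  the_instance :> instance rat;
  initial : allocation (agents the_instance) (goods the_instance);
  bound : nat }.

(* One row per agent listing its utilities for the single goods, then one row
   per agent with the indicator vector of its initial bundle, then the bound.
   The numbers of agents and goods can be read off the rows. *)
Definition encode_input (x : exchange_input) : seq symbol :=
  flatten [seq flatten [seq rcons (encode_rat (utility x i [set g])) Comma
                       | g <- enum 'I_(goods x)] ++ [:: Semicolon]
          | i <- enum 'I_(agents x)]
  ++ Hash ::
  flatten [seq [seq Bit (g \in bundle (initial x) i) | g <- enum 'I_(goods x)]
               ++ [:: Semicolon]
          | i <- enum 'I_(agents x)]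
  ++ Hash :: encode_nat (bound x).

Definition optimal_exchanges : decision_problem symbol :=
  @DecisionProblem symbol exchange_input encode_input
    (fun x => exists2 T, is_optimal_number (initial x) (Some T)
                       & (T <= bound x)%N).

(* Main.v *)
Require Import Defs.
From HB Require Import structures.
From mathcomp Require Import all_boot all_order all_algebra.
From mathcomp Require Import zify.

(* With identical binary utilities let [V] be the set of goods of value 1 and
   let agent [i] hold [s_i] goods, [v_i] of them in [V]; exchanges preserve
   [s_i].  An allocation is EF1 iff its values [v_i] differ by at most 1, that
   is, iff they are [q] or [q + 1] where [|V| = n q + r] and [r < n], with [r]
   agents of value [q + 1].  Target values [t_i <= s_i] with sum [|V|] are
   reached with [sum_i (v_i - t_i)] exchanges (truncated differences) and not
   with fewer.  The best targets give the [r] larger values to agents with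
   [v_i > q] as far as possible, so that [k] exchanges suffice iff all
   [s_i >= q], at most [n - r] agents have [s_i = q], and
   [sum_i (v_i - q) - min r #{i | v_i > q} <= k].

   This is decided by a machine with 13 stacks in one pass over the input: it
   compares all utility rows with the first one, divides [|V|] by [n] in unary,
   accumulates the left-hand side in unary while it reads the bundles, and
   compares it with the binary [k] by repeated halving.  The time bound comes
   from a quadratic potential that every step decreases. *)

Set Implicit Arguments.
Unset Strict Implicit.
Unset Printing Implicit Defensive.

(** * Stack machines *)

Inductive stack_op (T : Type) := Keep | Pop | Push of T.
Arguments Keep {T}.
Arguments Pop {T}.

Definition do_op (T : Type) (o : stack_op T) (s : seq T) : seq T :=
  match o with Keep => s | Pop => behead s | Push a => a :: s end.

Section StackMachine.

Variables (Sigma aux mode : finType) (k : nat) (start : mode).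
Variable verdict : mode -> option bool.
Local Notation gamma := (Sigma + aux)%type.
Variable delta : mode -> seq (option gamma) -> mode * (nat -> stack_op gamma).

Definition stack_config : Type := mode * seq (seq gamma).

Definition stack_step (c : stack_config) : stack_config :=
  if verdict c.1 is Some _ then c else
  let: (m, o) := delta c.1 (map ohead c.2) in
  (m, mkseq (fun i => do_op (o i) (nth [::] c.2 i)) (size c.2)).

Definition stack_init (w : seq Sigma) : stack_config :=
  (start, map inl w :: nseq k [::]).

Definition stack_top (pend : {ffun 'I_k.+1 -> option gamma})
    (cells : {ffun 'I_k.+1 -> cell Sigma aux}) :=
  [ffun i => if pend i is Some a then Some a else cells i].

(* Stack [i] occupies tape [i] from the head rightwards.  A move comes after
   the write, so a pushed symbol waits in the state until the next step. *)
Definition stack_machine : machine Sigma :=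
  @Machine Sigma k aux (mode * {ffun 'I_k.+1 -> option gamma})%type
    (start, [ffun=> None]) (fun q => verdict q.1)
    (fun q cells =>
       let tops := stack_top q.2 cells in
       let: (m, o) := delta q.1 [seq tops i | i <- enum 'I_k.+1] in
       ((m, [ffun i : 'I_k.+1 => if o i is Push a then Some a else None]),
        [ffun i : 'I_k.+1 =>
           (tops i, match o i with
                    | Keep => Stay | Pop => MoveRight | Push _ => MoveLeft
                    end)])).

(** The left cells are unconstrained: a push moves the head onto one of them, but the pending symbol
    hides it and overwrites it in the next step. Comparing [nth] with [onth] identifies trailing
    blanks with absent cells. *)
Definition simulates (c : config stack_machine) (s : stack_config) : Prop :=
  [/\ (current c).1 = s.1, size s.2 = k.+1
    & forall (i : 'I_k.+1) j,
        nth None ((if (current c).2 i is Some a then Some a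
                   else scanned (tapes c i)) :: right_cells (tapes c i)) j
        = onth (nth [::] s.2 i) j].

Lemma simulates_init w :
  simulates (init_config stack_machine w) (stack_init w).
Proof.
split=> //=; first by rewrite size_nseq.
move=> i j; rewrite !ffunE; case: eqP => [->|ni] /=.
  case: w => [|a w] /=; first by case: j => [|j] //=; rewrite nth_nil.
  case: j => [|j] //=.
  by elim: w j => [|b w IH] [|j] //=.
case: i ni => -[|i] lti ni /=; first by case: ni; apply: val_inj.
by rewrite nth_nseq if_same; case: j => [|j] //=; rewrite nth_nil.
Qed.

Lemma simulates_step c s : simulates c s -> simulates (step c) (stack_step s).
Proof.
case: s => m st; case: c => -[m' pend] t; case=> /= -> szs h.
rewrite /step /stack_step /=; case: (verdict m) => [b|]; first by split.
have -> : [seq stack_top pend [ffun i => scanned (t i)] i | i <- enum 'I_k.+1]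
    = map ohead st.
  apply: (@eq_from_nth _ None); first by rewrite size_map size_enum_ord size_map szs.
  move=> i; rewrite size_map size_enum_ord => lti.
  rewrite (nth_map ord0) ?size_enum_ord // (nth_map [::]) ?szs //.
  set x := nth ord0 _ i; rewrite !ffunE.
  transitivity (onth (nth [::] st x) 0); first exact: (h x 0).
  by rewrite /x nth_enum_ord //; case: (nth _ _ _).
case: (delta m _) => m1 o /=; split=> //=; first by rewrite size_mkseq.
move=> i j; rewrite !ffunE /= szs nth_mkseq //.
have := h i; move: (nth _ _ _) => s {}h.
case: (t i) h => l c r /= h.
case: (o i) => [||a] /=.
- by rewrite -h; case: (pend i).
- have hb n : nth None r n = onth (behead s) n.
    by have := h n.+1; case: s {h} => [|x s] //= ->; case: n.
  by rewrite -hb; case: r {h hb} => //=; case: j => //= j; rewrite nth_nil.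
- by case: j => [|j] //=; rewrite -h; case: j => //=; case: (pend i).
Qed.

Lemma outcome_stack_machine w t :
  outcome stack_machine w t = verdict (iter t stack_step (stack_init w)).1.
Proof.
rewrite /outcome.
suff: simulates (iter t (@step _ stack_machine) (init_config stack_machine w))
                (iter t stack_step (stack_init w)) by case=> /= ->.
elim: t => [|t IH] /=; [exact: simulates_init | exact: simulates_step].
Qed.

Definition accepts (c : stack_config) : Prop :=
  exists t, verdict (iter t stack_step c).1 = Some true.

Lemma stack_step_halted c b t :
  verdict c.1 = Some b -> iter t stack_step c = c.
Proof. by move=> h; elim: t => //= t ->; rewrite /stack_step h. Qed.

Lemma accepts_halted c b : verdict c.1 = Some b -> accepts c <-> b.
Proof.
move=> h; split=> [[t]|hb]; first by rewrite (stack_step_halted _ h) h => -[].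
by exists 0; rewrite /= h hb.
Qed.

(** [accepts] ignores time, so under an equivalence a configuration may be replaced by its
    successor. This allows symbolic execution of the machine. *)
Lemma accepts_step c : accepts c <-> accepts (stack_step c).
Proof.
split=> -[t ht]; last by exists t.+1; rewrite iterSr.
exists t; rewrite -iterSr iterS /stack_step.
by case E: (verdict _) (ht) => [b|//]; rewrite E.
Qed.

Lemma halts_within (inv : stack_config -> Prop) (pot : stack_config -> nat) c :
  (forall c, verdict c.1 = None -> inv c ->
     inv (stack_step c) /\ pot (stack_step c) < pot c) ->
  inv c ->
  forall t, pot c <= t -> exists b, verdict (iter t stack_step c).1 = Some b.
Proof.
move=> dec hc t; elim: t c hc => [|t IH] c hc ht.
  case E: (verdict c.1) => [b|]; first by exists b.
  by have [_] := dec _ E hc; rewrite ltnNge (leq_trans ht).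
case E: (verdict c.1) => [b|].
  by exists b; rewrite (stack_step_halted _ E).
by have [h1 h2] := dec _ E hc; rewrite iterSr; apply: IH => //; lia.
Qed.

(** Halted configurations are fixed, so the verdict at the time bound agrees with the verdict at any
    other halting time. Correctness and running time can thus be treated apart. *)
Lemma stack_machine_in_P (L : seq Sigma -> Prop) a d :
  (forall w, accepts (stack_init w) <-> L w) ->
  (forall w, exists b,
     verdict (iter (a * size w ^ d + a) stack_step (stack_init w)).1 = Some b) ->
  in_P L.
Proof.
move=> hL halt; exists stack_machine, a, d => w.
have [b hb] := halt w; exists b; rewrite outcome_stack_machine; split=> //.
rewrite -hL; split=> [bt|[t ht]]; first by exists (a * size w ^ d + a); rewrite hb bt.
set T := (a * _ + a) in hb.
have h1 : verdict (iter (t + T) stack_step (stack_init w)).1 = Some b.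
  by rewrite iterD (stack_step_halted _ hb).
by move: h1; rewrite addnC iterD (stack_step_halted _ ht) ht => -[].
Qed.

End StackMachine.

(** * The machine and its running time *)

(* The argument of [ReadUtility] tells whether no row, one row or more rows
   precede.  In [ReadBundle value_excess size_excess], the flags tell whether
   the values, resp. the goods, read so far in the row exceed the quotient. *)
Inductive mode :=
  | ReadUtility of option bool | ReadSlash of option bool
  | ReadOne of option bool | ReadComma of option bool
  | RewindUtility of bool
  | Divide | Refill
  | ReadBundle of bool & bool | RewindBundle | CheckTaken
  | ReadBound of bool & option bool
  | Halve of bool & bool & bool & bool | Unhalve of bool & bool
  | Halt of bool.

(** Serves to make [mode] a finite type. *)
Definition mode_code (m : mode) :
    (option bool * (bool * bool) + bool) + (bool * bool + bool * bool)
    + ((bool * option bool + (bool * bool) * (bool * bool))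
       + (bool * bool + bool)) :=
  match m with
  | ReadUtility r => inl (inl (inl (r, (false, false))))
  | ReadSlash r => inl (inl (inl (r, (false, true))))
  | ReadOne r => inl (inl (inl (r, (true, false))))
  | ReadComma r => inl (inl (inl (r, (true, true))))
  | RewindUtility r => inl (inl (inr r))
  | Divide => inl (inr (inl (false, false)))
  | Refill => inl (inr (inl (false, true)))
  | RewindBundle => inl (inr (inl (true, false)))
  | CheckTaken => inl (inr (inl (true, true)))
  | ReadBundle vx sx => inl (inr (inr (vx, sx)))
  | ReadBound le o => inr (inl (inl (le, o)))
  | Halve d par le ok => inr (inl (inr ((d, par), (le, ok))))
  | Unhalve le ok => inr (inr (inl (le, ok)))
  | Halt b => inr (inr (inr b))
  end.

Definition mode_decode c : mode :=
  match c with
  | inl (inl (inl (r, (false, false)))) => ReadUtility r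
  | inl (inl (inl (r, (false, true)))) => ReadSlash r
  | inl (inl (inl (r, (true, false)))) => ReadOne r
  | inl (inl (inl (r, (true, true)))) => ReadComma r
  | inl (inl (inr r)) => RewindUtility r
  | inl (inr (inl (false, false))) => Divide
  | inl (inr (inl (false, true))) => Refill
  | inl (inr (inl (true, false))) => RewindBundle
  | inl (inr (inl (true, true))) => CheckTaken
  | inl (inr (inr (vx, sx))) => ReadBundle vx sx
  | inr (inl (inl (le, o))) => ReadBound le o
  | inr (inl (inr ((d, par), (le, ok)))) => Halve d par le ok
  | inr (inr (inl (le, ok))) => Unhalve le ok
  | inr (inr (inr b)) => Halt b
  end.

Lemma mode_codeK : cancel mode_code mode_decode.
Proof. by case. Qed.

HB.instance Definition _ := Countable.copy mode (can_type mode_codeK).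
HB.instance Definition _ : isFinite mode := CanIsFinite mode_codeK.

Definition verdict_of (m : mode) : option bool :=
  if m is Halt b then Some b else None.

Local Notation gamma := (symbol + bool * bool)%type.
Local Notation tick := (inr (false, false) : gamma).

Fixpoint op_of (l : seq (nat * stack_op gamma)) (i : nat) : stack_op gamma :=
  if l is (j, o) :: l' then if i == j then o else op_of l' i else Keep.

(* Stacks 1 and 2 hold one entry (utility, taken) per good: the goods not yet
   read in the current row, and the reverse of those already read.  The other
   work stacks are unary counters.  Stack 3: [p = |V|], for the division.
   Stacks 4 and 5 add up to [n] during the division [p = q n + r]; then 5 holds
   what is left of [r] for agents with [v_i > q], and 4 bounds the number of
   further agents with [s_i = q].  Stack 6: bundles to come.  Stacks 7 and 8
   (values), resp. 9 and 10 (sizes), add up to [q], the first of each pair being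
   decremented while a bundle is read.  Stack 11: exchanges; 12: half of them. *)
Local Notation sIn := 0 (only parsing).
Local Notation sA := 1 (only parsing).
Local Notation sB := 2 (only parsing).
Local Notation sP := 3 (only parsing).
Local Notation sN := 4 (only parsing).
Local Notation sR := 5 (only parsing).
Local Notation sM := 6 (only parsing).
Local Notation sV := 7 (only parsing).
Local Notation sV' := 8 (only parsing).
Local Notation sS := 9 (only parsing).
Local Notation sS' := 10 (only parsing).
Local Notation sX := 11 (only parsing).
Local Notation sY := 12 (only parsing).

Definition reject : mode * seq (nat * stack_op gamma) := (Halt false, [::]).

Definition transition (m : mode) (t : nat -> option gamma) :
    mode * seq (nat * stack_op gamma) :=
  match m with
  | ReadUtility r =>
      match t sIn with
      | Some (inl (Bit b)) =>
          (* From the second row on, stack 1 dictates the utility; the first row is recorded and its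
             ones are counted on stack 3. *)
          if r is Some _ then
            if t sA is Some (inr (u, _)) then
              if u == b then
                (ReadSlash r, [:: (sIn, Pop); (sA, Pop); (sB, Push (inr (b, false)))])
              else reject
            else reject
          else
            (ReadSlash r, [:: (sIn, Pop), (sB, Push (inr (b, false)))
                            & if b then [:: (sP, Push tick)] else [::]])
      | Some (inl Semicolon) =>
          if (t sA, t sB) is (None, Some _) then
            (RewindUtility (r != None),
              [:: (sIn, Pop); (sN, Push tick); (sM, Push tick)])
          else reject
      | Some (inl Hash) =>
          (* [Some true] means that at least two rows, hence two agents, have been read. *)
          if (t sB, r) is (None, Some true) then (Divide, [:: (sIn, Pop)])
          else reject
      | _ => reject
      end
  | ReadSlash r =>
      if t sIn is Some (inl Slash) then (ReadOne r, [:: (sIn, Pop)]) else reject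
  | ReadOne r =>
      if t sIn is Some (inl (Bit true)) then (ReadComma r, [:: (sIn, Pop)])
      else reject
  | ReadComma r =>
      if t sIn is Some (inl Comma) then (ReadUtility r, [:: (sIn, Pop)])
      else reject
  | RewindUtility r =>
      if t sB is Some x then (RewindUtility r, [:: (sB, Pop); (sA, Push x)])
      else (ReadUtility (Some r), [::])
  | Divide =>
      match t sN, t sR, t sP with
      | None, None, _ => reject
      | None, Some _, _ =>
          (Refill, [:: (sR, Pop); (sN, Push tick); (sV, Push tick); (sS, Push tick)])
      | Some _, _, Some _ =>
          (Divide, [:: (sP, Pop); (sN, Pop); (sR, Push tick)])
      | Some _, _, None => (ReadBundle false false, [::])
      end
  | Refill =>
      if t sR is Some _ then (Refill, [:: (sR, Pop); (sN, Push tick)])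
      else (Divide, [::])
  | ReadBundle vx sx =>
      match t sIn with
      | Some (inl (Bit b)) =>
          if t sA is Some (inr (u, taken)) then
            if b && taken then reject else
            let good := [:: (sIn, Pop); (sA, Pop); (sB, Push (inr (u, taken || b)))] in
            if b then
              let: (sx', size_ops) :=
                if t sS is Some _ then (sx, [:: (sS, Pop); (sS', Push tick)])
                else (true, [::]) in
              let: (vx', value_ops) :=
                if ~~ u then (vx, [::])
                else if t sV is Some _ then (vx, [:: (sV, Pop); (sV', Push tick)])
                (* The first valuable good beyond [q] is free as long as [r] lasts; every other one
                   beyond [q] costs an exchange. *)
                else (true, if (vx, t sR) is (false, Some _) then [:: (sR, Pop)]
                            else [:: (sX, Push tick)]) in
              (ReadBundle vx' sx', good ++ size_ops ++ value_ops)
            else (ReadBundle vx sx, good)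
          else reject
      | Some (inl Semicolon) =>
          (* An empty stack 9 means that the bundle has at least [q] goods. If none went beyond [q],
             it has exactly [q], which uses up a unit of stack 4. *)
          if (t sA, t sB, t sS, t sM) is (None, Some _, None, Some _) then
            if sx then (RewindBundle, [:: (sIn, Pop); (sM, Pop)])
            else if t sN is Some _ then
              (RewindBundle, [:: (sIn, Pop); (sM, Pop); (sN, Pop)])
            else reject
          else reject
      | Some (inl Hash) =>
          if (t sB, t sM) is (None, None) then (CheckTaken, [:: (sIn, Pop)])
          else reject
      | _ => reject
      end
  | RewindBundle =>
      match t sB, t sV', t sS' with
      | Some x, _, _ => (RewindBundle, [:: (sB, Pop); (sA, Push x)])
      | None, Some _, _ => (RewindBundle, [:: (sV', Pop); (sV, Push tick)])
      | None, None, Some _ => (RewindBundle, [:: (sS', Pop); (sS, Push tick)])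
      | None, None, None => (ReadBundle false false, [::])
      end
  | CheckTaken =>
      match t sA with
      | Some (inr (_, true)) => (CheckTaken, [:: (sA, Pop)])
      | None => (ReadBound true None, [::])
      | _ => reject
      end
  | ReadBound le o =>
      match t sIn with
      | Some (inl (Bit d)) =>
          (* The most significant digit comes last; it may be 0 only if it is the sole digit. *)
          (Halve d false le (if o is Some _ then d else true), [:: (sIn, Pop)])
      | None =>
          (Halt (if (o, t sX) is (Some true, None) then le else false), [::])
      | _ => reject
      end
  | Halve d par le ok =>
      if t sX is Some _ then
        (Halve d (~~ par) le ok,
          (sX, Pop) :: if par then [:: (sY, Push tick)] else [::])
      else (Unhalve (if d == par then le else d) ok, [::])
  | Unhalve le ok =>
      if t sY is Some _ then (Unhalve le ok, [:: (sY, Pop); (sX, Push tick)])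
      else (ReadBound le (Some ok), [::])
  | Halt b => (Halt b, [::])
  end.

Definition delta_of (m : mode) (tops : seq (option gamma)) :
    mode * (nat -> stack_op gamma) :=
  let: (m', l) := transition m (nth None tops) in (m', op_of l).

Local Notation run_config := (stack_config symbol (bool * bool)%type mode).
Local Notation run_step :=
  (@stack_step symbol (bool * bool)%type mode verdict_of delta_of).
Local Notation run_accepts :=
  (@accepts symbol (bool * bool)%type mode verdict_of delta_of).
Local Notation run_init :=
  (@stack_init symbol (bool * bool)%type mode 12 (ReadUtility None)).

Definition stack_size (c : run_config) (i : nat) := size (nth [::] c.2 i).

(* The weights pay for the pushes: no step increases this sum. *)
Definition weighted_size (c : run_config) : nat :=
  let s := stack_size c in
  5 * s sIn + s sA + s sB + 2 * s sP + s sN + 3 * s sR + s sM + s sV + s sV'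
  + s sS + s sS' + s sX + s sY.

(** Bounds the steps until the next input symbol is read. In the division a tick is worth 3 on stack
    3 and 2 on stack 5, so moving it there spends a unit; in the halving, 2 on stack 11 and 1 on
    stack 12. *)
Definition loop_potential (c : run_config) : nat :=
  let s := stack_size c in
  match c.1 with
  | RewindUtility _ => s sB + 2
  | Divide => 3 * s sP + 2 * s sR + 2
  | Refill => 3 * s sP + 2 * s sR + 3
  | RewindBundle => s sB + s sV' + s sS' + 2
  | CheckTaken => s sA + 2
  | Halve _ _ _ _ => 2 * s sX + s sY + 3
  | Unhalve _ _ => s sY + 2
  | Halt _ => 0
  | _ => 1
  end.

(** For weighted size at most [z] the loop potential is at most [2 * z + 3], so each symbol read
    pays for the loop that it starts. *)
Definition potential (z : nat) (c : run_config) : nat :=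
  stack_size c sIn * (2 * z + 4) + loop_potential c.

Ltac destruct_scrutinee t :=
  lazymatch t with
  | match ?x with _ => _ end => destruct_scrutinee x
  | ohead ?x => destruct x
  | _ == _ => destruct t
  | ?b && _ => destruct_scrutinee b
  | ~~ ?b => destruct_scrutinee b
  | _ => is_var t; destruct t
  end.

Definition descends (z : nat) (c c' : run_config) : Prop :=
  (size c'.2 = 13 /\ weighted_size c' <= z) /\ potential z c' < potential z c.

Lemma potential_decreases z (c : run_config) :
  verdict_of c.1 = None -> size c.2 = 13 /\ weighted_size c <= z ->
  descends z c (run_step c).
Proof.
move=> hv [hs hz]; rewrite /stack_step hv /delta_of.
case: c hv hs hz => m st /= hv hs.
case: st hs => [|I [|A [|B [|P [|N [|R [|M [|V [|V' [|S [|S' [|X [|Y [|? ?]]]]]]]]]]]]]] //= _.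
case: m hv => [r|r|r|r|r|||vx sx|||le o|d par le ok|le ok|b] //= _ hz.
all: repeat lazymatch goal with |- _ ?c => destruct_scrutinee c; simpl end.
all: move: hz; rewrite /descends /potential /loop_potential /weighted_size /stack_size /= => hz.
all: repeat match goal with |- context [op_of ?l] => destruct_scrutinee l; simpl end.
all: split; [split=> // | rewrite ?[_.+1 * (_ + _)]mulSn];
  move: hz; clear; rewrite /=;
  repeat match goal with |- context [size ?x] => move: (size x) => {x} ? end.
(* The remaining input times [2 * z + 4] becomes a single unknown, which leaves linear
   arithmetic. *)
all: try (move: (_ * (2 * z + 4)) => ?); move=> /leP hz; apply/leP; lia.
Qed.

Lemma run_init_halts w :
  exists b, verdict_of (iter (15 * size w ^ 2 + 15) run_step (run_init w)).1 = Some b.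
Proof.
(* Initially only the input stack is nonempty, with weight 5 per symbol, so the potential is
   [size w * (10 * size w + 4) + 1]. *)
apply: (halts_within (inv := fun c => size c.2 = 13 /\ weighted_size c <= 5 * size w)
                     (pot := potential (5 * size w))).
- by move=> c hv hc; apply: potential_decreases.
- by rewrite /weighted_size /stack_size /stack_init /= size_map; split=> //; lia.
- rewrite /potential /loop_potential /stack_size /stack_init /= size_map; nia.
Qed.

(** * Accepted words *)

Definition conf (m : mode) (w : seq symbol) (A B : seq (bool * bool))
    (p n r M v v' s s' x y : nat) : run_config :=
  let counter j := nseq j tick in
  (m, [:: map inl w; map inr A; map inr B; counter p; counter n; counter r;
          counter M; counter v; counter v'; counter s; counter s';
          counter x; counter y]).

Lemma haltE b st : run_accepts (Halt b, st) <-> b.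
Proof. exact: accepts_halted erefl. Qed.

Lemma rejects st : run_accepts (Halt false, st) <-> False.
Proof. by apply: iff_trans; [exact: haltE | split]. Qed.

Lemma run_acceptsS m st : verdict_of m = None ->
  run_accepts (m, st) <->
  run_accepts (let: (m', l) := transition m (nth None (map ohead st)) in
            (m', [seq do_op (op_of l i) (nth [::] st i) | i <- iota 0 (size st)])).
Proof.
move=> hm; apply: (iff_trans (accepts_step _ _ _)).
by rewrite /stack_step /= hm /delta_of; case: transition.
Qed.

Ltac advance := apply: (iff_trans (run_acceptsS _ _)); [by []|]; rewrite /=.

(** * Reading the utility rows *)

Lemma rewind_utilityE r w A B p n r' M v v' s s' x y :
  run_accepts (conf (RewindUtility r) w A B p n r' M v v' s s' x y) <->
  run_accepts (conf (ReadUtility (Some r)) w (catrev B A) [::] p n r' M v v' s s' x y).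
Proof.
elim: B A => [|b B IH] A; first by advance.
by advance; exact: (IH (b :: A)).
Qed.

Definition utility_item (b : bool) : seq symbol :=
  [:: Bit b; Slash; Bit true; Comma].

Definition utility_row (us : seq bool) : seq symbol :=
  flatten [seq utility_item b | b <- us] ++ [:: Semicolon].

Definition untaken (us : seq bool) : seq (bool * bool) :=
  [seq (u, false) | u <- us].

Ltac rejected := apply: (iff_trans (rejects _)); split=> // -[? //].

Lemma read_suffixE r w A B p n r' M v v' s s' x y :
  run_accepts (conf (ReadSlash r) w A B p n r' M v v' s s' x y) <->
  exists2 w', w = [:: Slash, Bit true, Comma & w'] &
    run_accepts (conf (ReadUtility r) w' A B p n r' M v v' s s' x y).
Proof.
case: w => [|[b| | | |] w]; try (by advance; rejected).
advance; case: w => [|[[]| | | |] w]; try (by advance; rejected).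
advance; case: w => [|[b| | | |] w]; try (by advance; rejected).
advance; split=> [h|[w' [<-]] //]; by exists w.
Qed.

Local Notation uconf m w A B p n := (conf m w A B p n 0 n 0 0 0 0 0 0).

Ltac rejected_first := apply: (iff_trans (rejects _)); split=> // -[[|? ?] [? []]] //.

(** Nothing dictates the length of the first row, so the induction is on the remaining input. [B] is
    the reversed part of the row already read; a semicolon is accepted only after at least one
    good. *)
Lemma read_first_rowE w B p :
  run_accepts (uconf (ReadUtility None) w [::] B p 0) <->
  exists us w', [/\ w = utility_row us ++ w', (0 < size us + size B) &
    run_accepts (uconf (ReadUtility (Some false)) w' (catrev B (untaken us)) [::]
      (count id us + p) 1)].
Proof.
have [k] := ubnP (size w); elim: k w B p => // k IH w B p hk.
case: w hk => [|[b| | | |] w] hk; try (by advance; rejected_first).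
- have IHs q : run_accepts (uconf (ReadSlash None) w [::] ((b, false) :: B) q 0) <->
    exists us w', [/\ w = [:: Slash, Bit true, Comma & utility_row us ++ w'],
      0 < size us + size ((b, false) :: B) &
      run_accepts (uconf (ReadUtility (Some false)) w'
        (catrev ((b, false) :: B) (untaken us)) [::] (count id us + q) 1)].
    apply: (iff_trans (read_suffixE _ _ _ _ _ _ _ _ _ _ _ _ _ _)).
    split=> [[w1 ew]|[us [w1 [ew hs h]]]].
      have hk1 : size w1 < k by move: hk; rewrite ew /=; lia.
      by move/(IH _ _ _ hk1) => [us [w2 [ew2 hs h]]]; exists us, w2; rewrite ew ew2.
    have hk1 : size (utility_row us ++ w1) < k by move: hk; rewrite ew /=; lia.
    by exists (utility_row us ++ w1) => //; apply/(IH _ _ _ hk1); exists us, w1.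
  have step : run_accepts (uconf (ReadUtility None) (Bit b :: w) [::] B p 0) <->
      run_accepts (uconf (ReadSlash None) w [::] ((b, false) :: B) (b + p) 0).
    by advance; case: b {IHs hk}.
  apply: (iff_trans step); apply: (iff_trans (IHs _));
  split=> [[us [w1 [-> hs h]]]|[us [w1 [ew hs h]]]].
    exists (b :: us), w1; split=> //=.
    by rewrite (addnC (nat_of_bool b)) -addnA.
  case: us ew hs h => [|u us] //= [<- ->] hs h.
  exists us, w1; split=> //=; first by rewrite addnS.
  by rewrite addnA (addnC _ (nat_of_bool b)).
- case: B => [|b B]; first by advance; apply: (iff_trans (rejects _)); split=> // -[[|? ?] [? []]].
  advance; apply: (iff_trans (rewind_utilityE false w [::] (b :: B) p 1 0 1 0 0 0 0 0 0)).
  split=> [h|[[|u us] [w1 []]] //= [<-] _ //].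
  by exists [::], w.
- by case: B => [|b B]; advance; rejected_first.
Qed.

Ltac rejected_next := apply: (iff_trans (rejects _));
  split=> // -[[? ? [? //]]|[? [//]]].

(** Later rows are dictated by stack 1, so the induction is on the utilities still expected. The
    hash can come only at the beginning of a row, where [B] is empty. *)
Lemma read_next_rowE (r : bool) w us B p n :
  run_accepts (uconf (ReadUtility (Some r)) w (untaken us) B p n) <->
  [/\ r, B = [::] & exists2 w', w = Hash :: w' &
    run_accepts (uconf Divide w' (untaken us) [::] p n)] \/
  exists w', [/\ w = utility_row us ++ w', (0 < size us + size B) &
    run_accepts (uconf (ReadUtility (Some true)) w' (catrev B (untaken us)) [::] p n.+1)].
Proof.
elim: us w B => [|u us IH] w B.
  case: w => [|[b| | | |] w]; try (by advance; rejected_next).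
  - case: B => [|b B].
      advance; apply: (iff_trans (rejects _)); split=> // -[[? ? [? //]]|[? [//]]].
    advance; apply: (iff_trans (rewind_utilityE true w [::] (b :: B) p n.+1 0 n.+1 0 0 0 0 0 0)).
    split=> [h|[[//]|[w1 [[<-]]]] //]; by right; exists w.
  - case: B => [|b B]; last by advance; rejected_next.
    case: r; last by advance; rejected_next.
    advance; split=> [h|[[_ _ [? [<-] //]]|[? [//]]]]; by left; split=> //; exists w.
case: w => [|[b| | | |] w]; try (by advance; rejected_next).
- have [<-|nub] := eqVneq u b; last first.
    advance; rewrite (negbTE nub) /=; apply: (iff_trans (rejects _)).
    by split=> // -[[? ? [? //]]|[? [[eb]]]]; rewrite eb eqxx in nub.
  advance; rewrite eqxx /=.
  apply: (iff_trans (read_suffixE (Some r) w (untaken us) ((u, false) :: B) p n 0 n 0 0 0 0 0 0)).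
  split=> [[w1 -> /IH [[//]|[w2 [-> hs h]]]]|[[? ? [? //]]|[w1 [[->] hs h]]]].
    by right; exists w2; split.
  exists (utility_row us ++ w1) => //; apply/IH; right; exists w1; split=> //=.
  by rewrite addnS.
- case: B => [|b B]; last by advance; rejected_next.
  case: r {IH}; last by advance; rejected_next.
  advance; split=> [h|[[_ _ [? [<-] //]]|[? [//]]]]; by left; split=> //; exists w.
Qed.

Lemma read_utilitiesE w :
  run_accepts (run_init w) <->
  exists us j w', [/\ w = flatten (nseq j (utility_row us)) ++ Hash :: w',
    0 < size us, 1 < j & run_accepts (uconf Divide w' (untaken us) [::] (count id us) j)].
Proof.
(* Here [~~ r], read as a number, is the count of rows still required to have two in all. *)
have next us p n (r : bool) w1 : 0 < size us ->
    run_accepts (uconf (ReadUtility (Some r)) w1 (untaken us) [::] p n) <->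
    exists j w', [/\ w1 = flatten (nseq j (utility_row us)) ++ Hash :: w',
      ~~ r <= j & run_accepts (uconf Divide w' (untaken us) [::] p (j + n))].
  move=> hus; have [k] := ubnP (size w1); elim: k w1 r n => // k IH w1 r n hk.
  apply: (iff_trans (read_next_rowE _ _ _ _ _ _)); split.
    case=> [[-> _ [w' -> h]]|[w2 [ew hs]]]; first by exists 0, w'.
    have hk1 : size w2 < k by move: hk; rewrite ew size_cat /utility_row size_cat /=; lia.
    move/(IH _ _ _ hk1) => [j [w' [ew2 _ h]]].
    exists j.+1, w'; split; last by rewrite addSnnS.
      by rewrite ew ew2 /= catA.
    by case: r {hk ew}.
  case=> -[|j] [w' [ew hj h]].
    by left; split=> //; [case: r hj|exists w'].
  have ew2 : w1 = utility_row us ++ flatten (nseq j (utility_row us)) ++ Hash :: w'.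
    by rewrite ew /= catA.
  right; exists (flatten (nseq j (utility_row us)) ++ Hash :: w').
  rewrite addn0; split=> //; apply/IH; last by exists j, w'; rewrite addnS.
  by move: hk; rewrite ew2 /= size_cat /utility_row size_cat /=; lia.
apply: (iff_trans (read_first_rowE w [::] 0)); split.
  case=> us [w1 [ew /=]]; rewrite [size us + _]addn0 => hus /next; case=> // j [w' [ew1 hj h]].
  exists us, j.+1, w'; split=> //; first by rewrite ew ew1 /= catA.
  by rewrite addn1 [count _ _ + _]addn0 in h.
case=> us [[|j] [w' [ew hus // hj h]]].
exists us, (flatten (nseq j (utility_row us)) ++ Hash :: w'); split.
- by rewrite ew /= catA.
- by rewrite addn0.
- by apply/next => //; exists j, w'; split=> //; rewrite addn1 [count _ _ + _]addn0.
Qed.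

(** * Division and the reading of one bundle *)

Lemma refillE w A B p n r M v v' s s' x y :
  run_accepts (conf Refill w A B p n r M v v' s s' x y) <->
  run_accepts (conf Divide w A B p (n + r) 0 M v v' s s' x y).
Proof.
elim: r n => [|r IH] n; first by advance; rewrite addn0.
by advance; rewrite addnS -addSn; exact: (IH n.+1).
Qed.

(** [n + r] is the divisor and [r] the part of the dividend consumed in the current round, so
    [p + r] remains to be divided. A full round, [n = 0], is closed even when [p = 0], which keeps
    the remainder below the divisor. *)
Lemma divideE w A B p n r M q x y : 0 < n + r ->
  run_accepts (conf Divide w A B p n r M q 0 q 0 x y) <->
  run_accepts (conf (ReadBundle false false) w A B 0
    (n + r - (p + r) %% (n + r)) ((p + r) %% (n + r)) M
    (q + (p + r) %/ (n + r)) 0 (q + (p + r) %/ (n + r)) 0 x y).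
Proof.
elim: p n r q => [|p IH] n r q h0.
  case: n h0 => [|n] h0.
    case: r h0 => [|r] // _; advance.
    apply: (iff_trans (refillE w A B 0 1 r M q.+1 0 q.+1 0 x y)).
    advance; rewrite !add0n modnn divnn /= subn0 addn1.
    exact: iff_refl.
  advance; rewrite add0n modn_small ?divn_small; try lia.
  rewrite addn0 addnK; exact: iff_refl.
have step n' r' q' : run_accepts (conf Divide w A B p.+1 n'.+1 r' M q' 0 q' 0 x y) <->
    run_accepts (conf Divide w A B p n' r'.+1 M q' 0 q' 0 x y).
  by advance.
case: n h0 => [|n] h0.
  case: r h0 => [|r] // _; advance.
  apply: (iff_trans (refillE w A B p.+1 1 r M q.+1 0 q.+1 0 x y)).
  apply: (iff_trans (step _ _ _)).
  apply: (iff_trans (IH _ _ _ _)); first lia.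
  rewrite !add0n !addn1 modnDr divnDr ?dvdnn // divnn /= addn1 addnS -addSn.
  exact: iff_refl.
apply: (iff_trans (step _ _ _)).
apply: (iff_trans (IH _ _ _ _)); first lia.
rewrite !addnS !addSn; exact: iff_refl.
Qed.

(* [v] and [s] count the valuable goods, resp. the goods, met so far in the
   current row, [r0] and [x0] being the contents of stacks 5 and 11 before it. *)
Definition bundle_conf (m : bool -> bool -> mode) w A B n M q r0 x0 v s :=
  conf (m (q < v) (q < s)) w A B 0 n (r0 - (q < v)) M
    (q - v) (minn q v) (q - s) (minn q s) (x0 + (v - q) - minn r0 (q < v)) 0.

Lemma read_good_true w u A B n M q r0 x0 v s :
  run_accepts (bundle_conf ReadBundle (Bit true :: w) ((u, false) :: A) B n M q r0 x0 v s)
  <-> run_accepts (bundle_conf ReadBundle w A ((u, true) :: B) n M q r0 x0 (u + v) s.+1).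
Proof.
have used c : (q < c.+1 = if q - c is _.+1 then q < c else true) /\
    (minn q c.+1 = if q - c is _.+1 then (minn q c).+1 else minn q c).
  by case E: (q - c) => [|d]; split; lia.
have [hs1 hs2] := used s; have [hv1 hv2] := used v.
rewrite /bundle_conf hs1 hs2 subnS.
case: u; last by rewrite add0n; case: (q - s) => [|d]; advance; exact: iff_refl.
rewrite add1n.
have [x ex] : exists x, x = x0 + (v - q) - minn r0 (q < v) by eexists.
(* Below [q] a valuable good costs nothing and above [q] one exchange; at [q] it is the first excess
   good, which a unit of [r0] pays for if there is one. *)
have [hvq|[hvq|hvq]] : v < q \/ q < v \/ v = q by lia.
- have -> : x0 + (v.+1 - q) - minn r0 (q < v.+1) = x by lia.
  have -> : (q < v.+1) = false by lia.
  rewrite -ex hv2; have -> : (q < v) = false by lia.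
  have -> : q - v = (q - v.+1).+1 by lia.
  by case: (q - s) => [|d]; advance; exact: iff_refl.
- have -> : q < v.+1 by lia.
  have -> : x0 + (v.+1 - q) - minn r0 true = x.+1 by lia.
  rewrite -ex hv2; have -> : (q < v) = true by lia.
  have -> : q - v = 0 by lia.
  have -> : q - v.+1 = 0 by lia.
  by case: (r0 - true) => [|r1]; case: (q - s) => [|d]; advance; exact: iff_refl.
- rewrite -{}hvq in ex hv1 hv2 *; rewrite subnn subSnn ltnn ltnSn.
  have -> : v - v.+1 = 0 by lia.
  have -> : minn v v.+1 = minn v v by lia.
  have -> : x0 + 0 - minn r0 false = x0 by lia.
  rewrite subn0; case: r0 {ex} => [|r1].
    have -> : x0 + 1 - minn 0 true = x0.+1 by lia.
    by case: (_ - s) => [|d]; advance; exact: iff_refl.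
  have -> : x0 + 1 - minn r1.+1 true = x0 by lia.
  rewrite subn1 /=.
  by case: (_ - s) => [|d]; advance; exact: iff_refl.
Qed.

Lemma rewind_bundleE w A B n r M v v' s s' x y :
  run_accepts (conf RewindBundle w A B 0 n r M v v' s s' x y) <->
  run_accepts (conf (ReadBundle false false) w (catrev B A) [::] 0 n r M
    (v' + v) 0 (s' + s) 0 x y).
Proof.
elim: B A => [|b B IH] A; last by advance; exact: (IH (b :: A)).
elim: v' v => [|v' IH] v; last first.
  by advance; rewrite addSnnS; exact: (IH v.+1).
elim: s' s => [|s' IH] s; last by advance; rewrite addSnnS; exact: (IH s.+1).
by advance; exact: iff_refl.
Qed.

Definition bundle_row (bs : seq bool) : seq symbol :=
  [seq Bit b | b <- bs] ++ [:: Semicolon].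

Definition row_value (us bs : seq bool) : nat := count id (mask bs us).

Definition take_goods (ts bs : seq bool) : seq bool :=
  [seq p.1 || p.2 | p <- zip ts bs].

Definition conflict (ts bs : seq bool) : bool :=
  has (fun p => p.1 && p.2) (zip ts bs).

Ltac rejected_bundle := apply: (iff_trans (rejects _));
  split=> // -[[? ? [? //]]|[[|? ?] [? [//]]]].

(** Stated in the middle of a row, where [B], [v] and [s] account for the part already read, so that
    the induction is on the goods to come. The two alternatives are the end of the list of bundles
    and the completion of the row. *)
Lemma read_bundleE w us ts B n M q r0 x0 v s : size ts = size us ->
  run_accepts (bundle_conf ReadBundle w (zip us ts) B n M q r0 x0 v s) <->
  [/\ B = [::], M = 0 & exists2 w', w = Hash :: w' &
    run_accepts (bundle_conf (fun _ _ => CheckTaken) w' (zip us ts) [::] n M q r0 x0 v s)] \/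
  exists bs w', [/\ w = bundle_row bs ++ w', size bs = size us,
    ~~ conflict ts bs, 0 < size us + size B
  & [/\ 0 < M, q <= count id bs + s, (count id bs + s <= q) <= n &
    run_accepts (conf (ReadBundle false false) w'
       (catrev B (zip us (take_goods ts bs))) [::] 0
       (n - (count id bs + s <= q)) (r0 - (q < row_value us bs + v)) M.-1 q 0 q 0
       (x0 + (row_value us bs + v - q) - minn r0 (q < row_value us bs + v)) 0)]].
Proof.
elim: us ts w B v s => [|u us IH] [|t ts] w B v s //=.
  move=> _; case: w => [|[b| | | |] w]; try (by advance; rejected_bundle).
  - case: B => [|b B].
      by advance; apply: (iff_trans (rejects _)); split=> // -[[? ? [? //]]|[[|? ?] [? []]]].
    rewrite [in X in X <-> _]/bundle_conf.
    case E: (q - s) => [|d]; last first.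
      advance; apply: (iff_trans (rejects _)); split=> // -[[//]|[[|? ?] [? [//]]]] _ _ _ _ [_].
      by rewrite /=; lia.
    case: M => [|M].
      by advance; apply: (iff_trans (rejects _)); split=> // -[[//]|[[|? ?] [? [//]]]] _ _ _ _ [].
    (* A row of size above [q] and a row of size exactly [q] continue alike; they differ only in the
       new height [n'] of stack 4. *)
    have good n' : n' = n - (s <= q) ->
       (s <= q) <= n ->
       run_accepts (conf RewindBundle w [::] (b :: B) 0 n' (r0 - (q < v)) M
         (q - v) (minn q v) 0 (minn q s) (x0 + (v - q) - minn r0 (q < v)) 0)
      <-> [/\ b :: B = [::], M.+1 = 0 & exists2 w', Semicolon :: w = Hash :: w' &
         run_accepts (bundle_conf (fun _ _ => CheckTaken) w' [::] [::] n M.+1 q r0 x0 v s)]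
      \/ exists bs w', [/\ Semicolon :: w = bundle_row bs ++ w', size bs = 0,
          ~~ conflict [::] bs, 0 < 0 + (size B).+1 &
          [/\ 0 < M.+1, q <= count id bs + s, (count id bs + s <= q) <= n &
         run_accepts (conf (ReadBundle false false) w'
       (catrev (b :: B) (zip [::] (take_goods [::] bs))) [::] 0
       (n - (count id bs + s <= q)) (r0 - (q < row_value [::] bs + v)) M q 0 q 0
       (x0 + (row_value [::] bs + v - q) - minn r0 (q < row_value [::] bs + v)) 0)]].
      move=> -> hn.
      apply: (iff_trans (rewind_bundleE w [::] (b :: B) _ _ _ _ _ _ _ _ _)).
      have -> : minn q v + (q - v) = q by lia.
      have -> : minn q s + 0 = q by lia.
      split=> [h|[[//]|[bs [w1 [e hb _ _ [_ _ _]]]]]]; last by case: bs e hb => //= -[<-].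
      by right; exists [::], w; split=> //; split=> //; rewrite /=; lia.
    case hqs: (q < s).
      by advance; apply: good => //; lia.
    case: n good => [|n] good.
      advance; apply: (iff_trans (rejects _)); split=> // -[[//]|[[|? ?] [? [//]]]] _ _ _ _ [_ _].
      by rewrite /=; lia.
    by advance; apply: good => //; lia.
  - case: B => [|b B]; last by advance; rejected_bundle.
    rewrite /bundle_conf; case: M => [|M]; last by advance; rejected_bundle.
    advance; split=> [h|[[_ _ [? [<-] //]]|[[|? ?] [? [//]]]]]; by left; split=> //; exists w.
case=> hts; case: w => [|[b| | | |] w]; try (by advance; rejected_bundle).
- case: b => /=.
    case: t => /=.
      advance; apply: (iff_trans (rejects _)); split=> // -[[? ? [? //]]|[[|b bs] [? [//]]]].
      by case=> [[<- _] _]; rewrite /conflict.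
    apply: (iff_trans (read_good_true _ _ _ _ _ _ _ _ _ _ _)).
    apply: (iff_trans (IH _ _ _ _ _ hts)); split.
      case=> [[//]|[bs [w1 [-> hs hc h0 [hM hq hn h]]]]].
      right; exists (true :: bs), w1; split=> //=; first by rewrite hs.
      rewrite /row_value /= -/(row_value us bs) add1n addSnnS.
      by rewrite (addnC (nat_of_bool u)) -addnA; split.
    case=> [[? ? [? //]]|[[|b bs] [w1 [//]]]].
    case=> [[<- ->] [hs]] hc _ [hM hq hn h].
    right; exists bs, w1; split=> //; first by rewrite addnS.
    move: hq hn h; rewrite /row_value /= -/(row_value us bs) add1n addSnnS.
    by rewrite (addnC (nat_of_bool u)) -addnA; split.
  have step : run_accepts (bundle_conf ReadBundle (Bit false :: w) ((u, t) :: zip us ts) B n M q r0 x0 v s)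
     <-> run_accepts (bundle_conf ReadBundle w (zip us ts) ((u, t) :: B) n M q r0 x0 v s).
    by rewrite /bundle_conf; advance; rewrite orbF; exact: iff_refl.
  apply: (iff_trans step).
  apply: (iff_trans (IH _ _ _ _ _ hts)); split.
    case=> [[//]|[bs [w1 [-> hs hc h0 [hM hq hn h]]]]].
    right; exists (false :: bs), w1; split=> //=; first by rewrite hs.
      by rewrite /conflict /= andbF.
    by rewrite orbF; split.
  case=> [[? ? [? //]]|[[|b bs] [w1 [//]]]].
  case=> [[<- ->] [hs]]; rewrite /conflict /= andbF => hc _; rewrite orbF => -[hM hq hn h].
  right; exists bs, w1; split=> //; first by rewrite addnS.
- case: B => [|b B]; last by advance; rejected_bundle.
  rewrite /bundle_conf; case: M {IH} => [|M]; last by advance; rejected_bundle.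
  advance; split=> [h|[[_ _ [? [<-] //]]|[[|? ?] [? [//]]]]]; by left; split=> //; exists w.
Qed.

Lemma check_takenE w us ts n r M v v' s s' x : size ts = size us ->
  run_accepts (conf CheckTaken w (zip us ts) [::] 0 n r M v v' s s' x 0) <->
  all id ts /\
  run_accepts (conf (ReadBound true None) w [::] [::] 0 n r M v v' s s' x 0).
Proof.
elim: us ts => [|u us IH] [|t ts] //=.
  by move=> _; advance; split=> [|[]].
case=> hts; case: t => /=; last by advance; apply: (iff_trans (rejects _)); split=> // -[].
by advance; exact: IH.
Qed.

(** * The comparison with the binary bound *)

Definition bound_value (ds : seq bool) : nat := foldr (fun (d : bool) k => d + k.*2) 0 ds.

Definition last_digit (o : option bool) (ds : seq bool) : option bool :=
  foldl (fun o d => Some (if o is Some _ then d else true)) o ds.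

Lemma unhalveE le ok w A B p n r M v v' s s' x y :
  run_accepts (conf (Unhalve le ok) w A B p n r M v v' s s' x y) <->
  run_accepts (conf (ReadBound le (Some ok)) w A B p n r M v v' s s' (y + x) 0).
Proof.
elim: y x => [|y IH] x; first by advance; exact: iff_refl.
by advance; rewrite addSnnS; exact: (IH x.+1).
Qed.

Lemma halveE d par le ok w A B p n r M v v' s s' x y :
  run_accepts (conf (Halve d par le ok) w A B p n r M v v' s s' x y) <->
  run_accepts (conf (ReadBound (if d == par (+) odd x then le else d) (Some ok))
    w A B p n r M v v' s s' (y + (par + x)./2) 0).
Proof.
elim: x par y => [|x IH] par y.
  advance; apply: (iff_trans (unhalveE _ _ w A B p n r M v v' s s' 0 y)).
  by rewrite addn0 addbF addn0; case: par; rewrite ?addn0; exact: iff_refl.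
advance; case: par.
  apply: (iff_trans (IH false y.+1)).
  by rewrite addSnnS /= add0n negbK; exact: iff_refl.
apply: (iff_trans (IH true y)).
exact: iff_refl.
Qed.

(* The comparison proceeds from the least significant bit: [le] is the answer
   for the bits already read. *)
Lemma read_boundE le o w A B p n r M v v' s s' x :
  run_accepts (conf (ReadBound le o) w A B p n r M v v' s s' x 0) <->
  exists2 ds, w = [seq Bit d | d <- ds] &
    last_digit o ds = Some true /\
    (x < bound_value ds) || (x == bound_value ds) && le.
Proof.
elim: w le o x => [|a w IH] le o x.
  advance; apply: (iff_trans (haltE _ _)).
  split=> [h|[[|//] _ [/= -> h]]]; first exists [::] => //.
    by case: o h => [[]|] //; case: x.
  by case: x h.
case: a => [d| | | |];
  try by advance; apply: (iff_trans (rejects _)); split=> // -[[|? ?]].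
advance; apply: (iff_trans (halveE d false _ _ w A B p n r M v v' s s' x 0)).
rewrite add0n addFb add0n; apply: (iff_trans (IH _ _ _)).
(* The halves decide unless they are equal; then the lowest bits decide, and if these agree too, the
   earlier answer [le]. *)
have cmp ds : (x./2 < bound_value ds) || (x./2 == bound_value ds) && (if d == odd x then le else d)
   = (x < d + (bound_value ds).*2) || (x == d + (bound_value ds).*2) && le.
  have := odd_double_half x; move: (x./2) (bound_value ds) => h k; clear.
  case: (odd x) d le => -[] [] /= <-; lia.
split=> [[ds -> [hl hc]]|[[//|e ds] [<- ->] [hl hc]]].
  by exists (d :: ds) => //; rewrite /= -cmp.
by exists ds => //; rewrite cmp.
Qed.

(** * The list of bundles and the whole word *)

Lemma conflict_nth ts bs : size ts = size bs ->
  ~~ conflict ts bs <-> forall g, nth false ts g + nth false bs g <= 1.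
Proof.
rewrite /conflict; elim: ts bs => [|t ts IH] [|b bs] //=.
  by move=> _; split=> // _ g; rewrite nth_nil.
case=> hs; rewrite negb_or; split.
  by case/andP=> htb /(IH _ hs) h [|g] //=; case: t b htb => -[].
move=> h; apply/andP; split; first by have := h 0; case: t b {h} => -[].
by apply/IH => // g; exact: (h g.+1).
Qed.

Lemma take_goods_nth ts bs g : size ts = size bs ->
  nth false (take_goods ts bs) g = nth false ts g || nth false bs g.
Proof.
rewrite /take_goods; elim: ts bs g => [|t ts IH] [|b bs] [|g] //=.
by case=> hs; rewrite IH.
Qed.

Lemma size_take_goods ts bs : size ts = size bs -> size (take_goods ts bs) = size bs.
Proof. by move=> hs; rewrite size_map size2_zip // hs. Qed.

Definition bundle_rows (rows : seq (seq bool)) : seq symbol :=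
  flatten [seq bundle_row bs | bs <- rows].

Lemma bundle_conf0 w A B n M q r x :
  conf (ReadBundle false false) w A B 0 n r M q 0 q 0 x 0
  = bundle_conf ReadBundle w A B n M q r x 0 0.
Proof. by rewrite /bundle_conf ltn0 /= !minn0 sub0n addn0 !subn0. Qed.

(** [ts] marks the goods taken by earlier bundles. The conflict tests bound each column sum by 1,
    and the final check that all goods are taken makes it equal to 1. *)
Lemma read_bundlesE w us ts n M q r x : size ts = size us -> 0 < size us ->
  run_accepts (conf (ReadBundle false false) w (zip us ts) [::] 0 n r M q 0 q 0 x 0) <->
  exists rows w', [/\ w = bundle_rows rows ++ Hash :: w', size rows = M,
    all (fun bs => (size bs == size us) && (q <= count id bs)) rows,
    count (fun bs => count id bs <= q) rows <= n
  & (forall g, g < size us ->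
       nth false ts g + \sum_(bs <- rows) nth false bs g = 1) /\
    exists2 ds, w' = [seq Bit d | d <- ds] & last_digit None ds = Some true /\
      x + \sum_(bs <- rows) (row_value us bs - q)
       - minn r (count (fun bs => q < row_value us bs) rows) <= bound_value ds].
Proof.
move=> + hus; elim: M w ts n r x => [|M IH] w ts n r x hts.
all: rewrite bundle_conf0.
all: apply: (iff_trans (read_bundleE _ _ _ _ _ _ _ _ _ hts)); split.
- case=> [[_ _ [w' -> /(check_takenE _ _ _ _ _ _ _ _ _ hts)]]|[? [? [_ _ _ _ []]]] //].
  case=> hall h; exists [::], w'; split=> //; split.
    move=> g hg; rewrite big_nil addn0.
    by have /allP/(_ (nth false ts g)) := hall; rewrite mem_nth ?hts //; case: nth => // ->.
  move/read_boundE: h => [ds -> [hl h]]; exists ds => //; split=> //.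
  by move: h; rewrite big_nil andbT ltn0 /= !minn0 sub0n addn0 orbC -leq_eqVlt.
- case=> rows [w' [-> /size0nil -> _ _ [hg [ds hds [hl h]]]]].
  left; split=> //; exists w' => //; apply/(check_takenE _ _ _ _ _ _ _ _ _ hts); split.
    apply/(all_nthP false) => g; rewrite hts => /hg; rewrite big_nil addn0.
    by case: nth.
  apply/read_boundE; exists ds => //; split=> //.
  by move: h; rewrite big_nil andbT ltn0 /= !minn0 sub0n addn0 orbC -leq_eqVlt.
- case=> [[//]|[bs [w1 [-> hbs hc _ [_ hq hn]]]]].
  have htb : size ts = size bs by rewrite hts hbs.
  have htg : size (take_goods ts bs) = size us by rewrite size_take_goods.
  move/(IH _ _ _ _ _ htg) => [rows [w' [-> hr hall hcnt [hg [ds hds [hl h]]]]]].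
  exists (bs :: rows), w'; split=> /=.
  + by rewrite /bundle_rows /= catA.
  + by rewrite hr.
  + by rewrite hbs eqxx hall; lia.
  + by rewrite addn0 in hcnt hn; lia.
  split.
    move=> g hgs; have := hg g hgs; rewrite take_goods_nth // big_cons.
    have /conflict_nth := hc; move/(_ htb g).
    by case: (nth false ts g); case: (nth false bs g) => //=; lia.
  exists ds => //; split=> //; move: h; rewrite big_cons addn0.
  set S := (\sum_(_ <- _) _); set C := count _ _; set V := row_value us bs.
  (* [r] is spent greedily, one unit per agent above the quotient, so the shares of this row and of
     the later ones add up to one minimum. *)
  have -> // : x + (V - q) - minn r (q < V) + S - minn (r - (q < V)) C
    = x + (V - q + S) - minn r ((q < V) + C) by lia.
- case=> -[[w' [_ //]]|bs rows [w' [-> [hr] /= /andP[/andP[/eqP hbs hq] hall] hcnt [hg [ds hds [hl h]]]]]].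
  have htb : size ts = size bs by rewrite hts hbs.
  have htg : size (take_goods ts bs) = size us by rewrite size_take_goods.
  right; exists bs, (bundle_rows rows ++ Hash :: w'); split=> //.
  + by rewrite /bundle_rows /= catA.
  + apply/(conflict_nth htb) => g; have [hgs|hgs] := ltnP g (size us).
      by have := hg g hgs; rewrite big_cons; lia.
    by rewrite !nth_default ?hbs ?hts.
  + by rewrite addn0.
  rewrite addn0; split=> //; [lia|].
  apply/(IH _ _ _ _ _ htg); exists rows, w'; split=> //; [lia|].
  split.
    move=> g hgs; have := hg g hgs; rewrite take_goods_nth // big_cons.
    by case: (nth false ts g); case: (nth false bs g) => //=; lia.
  exists ds => //; split=> //; move: h; rewrite big_cons addn0.
  set S := (\sum_(_ <- _) _); set C := count _ _; set V := row_value us bs.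
  have -> // : x + (V - q) - minn r (q < V) + S - minn (r - (q < V)) C
    = x + (V - q + S) - minn r ((q < V) + C) by lia.
Qed.

Lemma untakenE us : untaken us = zip us (nseq (size us) false).
Proof. by elim: us => //= u us ->. Qed.

(** Describes the accepted words without reference to the machine; the division and the bundles
    start from empty counters and no good taken. *)
Lemma accepts_encodingE w :
  run_accepts (run_init w) <->
  exists us n rows ds,
  [/\ w = flatten (nseq n (utility_row us)) ++
            Hash :: bundle_rows rows ++ Hash :: [seq Bit d | d <- ds],
      0 < size us /\ 1 < n,
      size rows = n /\ all (fun bs => size bs == size us) rows,
      forall g, g < size us -> \sum_(bs <- rows) nth false bs g = 1
    & last_digit None ds = Some true /\
      let q := count id us %/ n in
      let r := count id us %% n in
      [/\ all (fun bs => q <= count id bs) rows,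
          count (fun bs => count id bs <= q) rows <= n - r
        & \sum_(bs <- rows) (row_value us bs - q)
          - minn r (count (fun bs => q < row_value us bs) rows) <= bound_value ds]].
Proof.
have nth_untaken us g : nth false (nseq (size us) false) g = false.
  by rewrite nth_nseq if_same.
apply: (iff_trans (read_utilitiesE _)); split.
  case=> us [n [w1 [-> hus hn]]].
  have n0 : 0 < n + 0 by rewrite addn0 ltnW.
  move/(divideE _ _ _ _ _ _ _ _ n0).
  rewrite untakenE !addn0 add0n.
  move/(read_bundlesE _ _ _ _ _ _ (size_nseq _ _) hus).
  case=> rows [w2 [-> hr hall hcnt [hg [ds -> [hl h]]]]].
  exists us, n, rows, ds; split=> //.
  - by split=> //; apply: sub_all hall => bs /andP[].
  - by move=> g /hg; rewrite nth_untaken.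
  split=> //; split=> //; by apply: sub_all hall => bs /andP[].
case=> us [n [rows [ds [-> [hus hn] [hr hall] hg [hl [hq hcnt hx]]]]]].
exists us, n, (bundle_rows rows ++ Hash :: [seq Bit d | d <- ds]); split=> //.
apply/divideE; first by rewrite addn0 ltnW.
rewrite untakenE !addn0 add0n.
apply/(read_bundlesE _ _ _ _ _ _ (size_nseq _ _) hus).
exists rows, [seq Bit d | d <- ds]; split=> //.
- apply/allP => bs hbs; move/allP: hall => /(_ _ hbs) ->.
  by move/allP: hq => /(_ _ hbs).
split; last by exists ds.
by move=> g /hg; rewrite nth_untaken.
Qed.

(** * Exchanges *)

Section Exchanges.

Variables n m : nat.
Implicit Types (A B : allocation n m) (V : {set 'I_m}).

Lemma bundle_disjoint A i j : i != j -> [disjoint bundle A i & bundle A j].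
Proof. by move=> ij; case/andP: (valP A) => /forallP/(_ i)/forallP/(_ j)/implyP/(_ ij). Qed.

Lemma bundle_cover A g : exists i, g \in bundle A i.
Proof.
case/andP: (valP A) => _ /eqP/setP/(_ g); rewrite inE => /bigcupP[i _ h].
by exists i.
Qed.

Lemma bundle_inj A g i j : g \in bundle A i -> g \in bundle A j -> i = j.
Proof.
move=> gi gj; apply/eqP; apply: contraT => /(bundle_disjoint A).
by rewrite disjoint_subset => /subsetP/(_ _ gi); rewrite inE gj.
Qed.

Definition worth V A i := #|bundle A i :&: V|.

Lemma sum_worth V A : \sum_i worth V A i = #|V|.
Proof.
(* The goods of [V] are grouped by owner, which [xchoose] picks from [bundle_cover]. *)
rewrite /worth -sum1_card (partition_big (fun g => xchoose (bundle_cover A g)) predT) //=.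
apply: eq_bigr => i _; rewrite -sum1_card; apply: eq_bigl => g; rewrite !inE andbC.
congr (_ && _); apply/idP/eqP => [gi|<-]; last exact: (xchooseP (bundle_cover A g)).
exact: bundle_inj (xchooseP (bundle_cover A g)) gi.
Qed.

Lemma worth_le V A i : worth V A i <= #|bundle A i|.
Proof. by rewrite subset_leq_card ?subsetIl. Qed.

(** Written with sums on both sides to avoid truncated subtraction. For the full set [V] it also
    yields that bundle sizes are preserved. *)
Lemma swap_worth V (S : {set 'I_m}) g g' : g \in S -> g' \notin S ->
  #|((S :|: [set g']) :\ g) :&: V| + (g \in V) = #|S :&: V| + (g' \in V).
Proof.
move=> gS g'S.
have -> : (S :|: [set g']) :\ g = g' |: (S :\ g).
  apply/setP => h; rewrite !inE; have [->|_] := eqVneq h g'; last by rewrite orbF.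
  by rewrite orbT andbT orTb; apply: contraNneq g'S => ->.
rewrite setIUl (cardsD1 g (S :&: V)) inE gS setIDAC.
rewrite cardsU; have -> : #|[set g'] :&: V| = (g' \in V).
  rewrite -sum1_card (eq_bigl (fun h => (h == g') && (g' \in V))); last first.
    by move=> h; rewrite !inE; case: eqP => // ->.
  by case: (g' \in V); [rewrite (eq_bigl _ _ (fun h => andbT _)) big_pred1_eq
    | rewrite (eq_bigl _ _ (fun h => andbF _)) big_pred0_eq].
have -> : [set g'] :&: V :&: ((S :&: V) :\ g) = set0.
  by apply/setP => h; rewrite !inE; have [->|] := eqVneq h g'; rewrite ?(negbTE g'S) ?andbF.
rewrite cards0 subn0 /=; lia.
Qed.

Lemma exchange_card A B i : exchange A B -> #|bundle B i| = #|bundle A i|.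
Proof.
case/existsP=> a /existsP[b] /existsP[g] /existsP[g'] /and5P[ab ga g'b /eqP Ba].
case/andP=> /eqP Bb /forallP Bk.
have g'a : g' \notin bundle A a by apply: contraNN ab => h; rewrite (bundle_inj h g'b).
have gb : g \notin bundle A b by apply: contraNN ab => h; rewrite (bundle_inj ga h).
have [->|ia] := eqVneq i a.
  by have := swap_worth [set: 'I_m] ga g'a; rewrite !setIT !inE -Ba; lia.
have [->|ib] := eqVneq i b.
  by have := swap_worth [set: 'I_m] g'b gb; rewrite !setIT !inE -Bb; lia.
by have /implyP/(_ _)/eqP -> // := Bk i; rewrite ia ib.
Qed.

(** The two agents change their worth by opposite amounts of at most 1, so at most one of them
    loses, and the total excess over the targets drops by at most 1. *)
Lemma exchange_worth V A B (t : 'I_n -> nat) : exchange A B ->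
  \sum_i (worth V A i - t i) <= (\sum_i (worth V B i - t i)).+1.
Proof.
case/existsP=> a /existsP[b] /existsP[g] /existsP[g'] /and5P[ab ga g'b /eqP Ba].
case/andP=> /eqP Bb /forallP Bk.
have g'a : g' \notin bundle A a by apply: contraNN ab => h; rewrite (bundle_inj h g'b).
have gb : g \notin bundle A b by apply: contraNN ab => h; rewrite (bundle_inj ga h).
have wa := swap_worth V ga g'a; have wb := swap_worth V g'b gb.
rewrite -Ba -/(worth V B a) -/(worth V A a) in wa.
rewrite -Bb -/(worth V B b) -/(worth V A b) in wb.
rewrite (bigD1 a) // (bigD1 b) 1?eq_sym //=.
rewrite [in leqRHS](bigD1 a) // [in leqRHS](bigD1 b) 1?eq_sym //=.
have -> : \sum_(i | (i != a) && (i != b)) (worth V A i - t i)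
    = \sum_(i | (i != a) && (i != b)) (worth V B i - t i).
  by apply: eq_bigr => i hi; rewrite /worth; have /implyP/(_ hi)/eqP -> := Bk i.
by move: wa wb; case: (g \in V); case: (g' \in V) => /= wa wb; lia.
Qed.

Lemma path_exchange_worth V (t : 'I_n -> nat) A s :
  path (@exchange n m) A s ->
  (forall i, #|bundle (last A s) i| = #|bundle A i|) /\
  \sum_i (worth V A i - t i) <= size s + \sum_i (worth V (last A s) i - t i).
Proof.
elim: s A => [|B s IH] A //= /andP[AB /IH[hc hw]]; split.
  by move=> i; rewrite hc (exchange_card i AB).
by apply: leq_trans (exchange_worth V t AB) _; rewrite addSn ltnS.
Qed.

Definition swap_bundles (A : allocation n m) (a b : 'I_n) (g g' : 'I_m) :
    {ffun 'I_n -> {set 'I_m}} :=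
  [ffun i => if i == a then (bundle A a :|: [set g']) :\ g
             else if i == b then (bundle A b :|: [set g]) :\ g'
             else bundle A i].

Lemma swap_bundles_allocation A a b g g' :
  a != b -> g \in bundle A a -> g' \in bundle A b ->
  is_allocation (swap_bundles A a b g g').
Proof.
move=> ab ga g'b.
have gg' : g != g' by apply: contraNneq ab => e; apply/eqP/(bundle_inj ga); rewrite e.
(* [h] has the owner that [swap h] had before. *)
pose swap h := if h == g then g' else if h == g' then g else h.
have inB i h : (h \in swap_bundles A a b g g' i) = (swap h \in bundle A i).
  have uniq x j k : x \in bundle A j -> (x \in bundle A k) = (j == k).
    by move=> xj; apply/idP/eqP => [/(bundle_inj xj)//|<-].
  rewrite ffunE /swap; have [->|ia] := eqVneq i a.
    rewrite !inE; have [->|hg] := eqVneq h g; first by rewrite (uniq _ _ _ g'b) [b == a]eq_sym (negbTE ab).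
    by have [_|] := eqVneq h g'; rewrite ?orbT ?ga ?orbF.
  have [->|ib] := eqVneq i b.
    rewrite !inE; have [->|hg'] := eqVneq h g'.
      by rewrite [g' == g]eq_sym (negbTE gg') (uniq _ _ _ ga) (negbTE ab).
    by have [_|] := eqVneq h g; rewrite ?orbT ?g'b ?orbF.
  have [->|hg] := eqVneq h g.
    by rewrite (uniq _ _ _ ga) (uniq _ _ _ g'b) ![_ == i]eq_sym (negbTE ia) (negbTE ib).
  have [->|//] := eqVneq h g'.
  by rewrite (uniq _ _ _ ga) (uniq _ _ _ g'b) ![_ == i]eq_sym (negbTE ia) (negbTE ib).
apply/andP; split.
  apply/forallP => i; apply/forallP => j; apply/implyP => ij.
  rewrite disjoint_subset; apply/subsetP => h; rewrite inE !inB => hi.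
  by apply: contraNN ij => /(bundle_inj hi)->.
apply/eqP/setP => h; rewrite !inE; apply/bigcupP.
by have [i hi] := bundle_cover A (swap h); exists i => //; rewrite inB.
Qed.

(** Since the totals agree, an agent above its target forces another below. Exchanging a good of [V]
    of the former for one outside [V] of the latter lowers the total excess by exactly 1. *)
Lemma reach_worth V A (t : 'I_n -> nat) :
  (forall i, t i <= #|bundle A i|) -> \sum_i t i = #|V| ->
  exists s, [/\ size s = \sum_i (worth V A i - t i), path (@exchange n m) A s
    & forall i, worth V (last A s) i = t i].
Proof.
move=> + tV; have [d] := ubnP (\sum_i (worth V A i - t i)).
elim: d A => // d IH A hd ht.
have tA : \sum_i worth V A i = \sum_i t i by rewrite sum_worth.
have [/forallP le_wt|] := boolP [forall i, worth V A i <= t i].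
  exists [::]; split=> //=.
    by apply/esym/eqP; rewrite sum_nat_eq0; apply/forallP => i; rewrite subn_eq0 le_wt.
  (* Termwise inequality with equal sums forces termwise equality. *)
  move=> i; apply/eqP; have := leqif_sum (fun i (_ : true) => conj (le_wt i) (erefl (worth V A i == t i))).
  by case=> _; rewrite tA eqxx => /esym/forallP/(_ i).
rewrite negb_forall => /existsP[a]; rewrite -ltnNge => ta.
have [b bt] : exists b, worth V A b < t b.
  apply/existsP; apply: contraT; rewrite negb_exists => /forallP h.
  have lt : \sum_i t i < \sum_i worth V A i.
    rewrite (bigD1 a) //= [ltnRHS](bigD1 a) //= -addSn leq_add // leq_sum // => i _.
    by rewrite leqNgt.
  by rewrite tA ltnn in lt.
have ab : a != b by apply/eqP => e; rewrite e in ta; lia.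
have [g] : exists g, g \in bundle A a :&: V by apply/card_gt0P; rewrite -/(worth V A a); lia.
rewrite inE => /andP[ga gV].
(* Agent [b] has a good outside [V] because its worth is below [t b], which is at most its bundle
   size. *)
have [g'] : exists g', g' \in bundle A b :\: V.
  apply/card_gt0P; have := cardsID V (bundle A b); rewrite -/(worth V A b).
  by have := ht b; lia.
rewrite inE => /andP[g'V g'b].
pose B : allocation n m := exist (fun C => is_allocation C) _ (swap_bundles_allocation ab ga g'b).
have AB : exchange A B.
  apply/existsP; exists a; apply/existsP; exists b.
  apply/existsP; exists g; apply/existsP; exists g'.
  rewrite ab ga g'b /bundle /= !ffunE eqxx [b == a]eq_sym (negbTE ab) !eqxx /=.
  by apply/forallP => k; apply/implyP => /andP[/negbTE ka /negbTE kb]; rewrite ffunE ka kb.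
have wB i : worth V B i = if i == a then (worth V A a).-1 else
     if i == b then (worth V A b).+1 else worth V A i.
  rewrite {1}/worth /bundle /= ffunE; case: eqP => [_|_].
    have g'a : g' \notin bundle A a by apply: (contraNN _ ab) => h; rewrite (bundle_inj h g'b).
    by have := swap_worth V ga g'a; rewrite gV (negbTE g'V) -/(worth V A a) addn0 addn1 => <-.
  case: eqP => [_|//].
  have gb : g \notin bundle A b by apply: (contraNN _ ab) => h; rewrite (bundle_inj ga h).
  by have := swap_worth V g'b gb; rewrite gV (negbTE g'V) -/(worth V A b) addn0 addn1.
have sB : \sum_i (worth V A i - t i) = (\sum_i (worth V B i - t i)).+1.
  rewrite (bigD1 a) // (bigD1 b) 1?eq_sym //= [in RHS](bigD1 a) // [in RHS](bigD1 b) 1?eq_sym //=.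
  rewrite !wB eqxx [b == a]eq_sym (negbTE ab) eqxx.
  have -> : \sum_(i | (i != a) && (i != b)) (worth V B i - t i)
    = \sum_(i | (i != a) && (i != b)) (worth V A i - t i).
    by apply: eq_bigr => i /andP[/negbTE ia /negbTE ib]; rewrite wB ia ib.
  move: (\sum_(_ | _) _) (worth V A a) (worth V A b) (t a) (t b) ta bt.
  by clear=> *; lia.
have [||s [ss ps ls]] := IH B; first by lia.
  by move=> i; rewrite (exchange_card i AB).
by exists (B :: s); split=> //=; rewrite ?ss ?AB.
Qed.

End Exchanges.

Lemma subset_of_card (T : finType) (H S : {set T}) k :
  H \subset S -> #|H| <= k <= #|S| ->
  exists E : {set T}, [/\ H \subset E, E \subset S & #|E| = k].
Proof.
have [d] := ubnP (k - #|H|); elim: d H => // d IH H hd HS /andP[Hk kS].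
have [e|ne] := eqVneq #|H| k; first by exists H.
have [x] : exists x, x \in S :\: H.
  by apply/card_gt0P; have := cardsD S H; rewrite (setIidPr HS); lia.
rewrite inE => /andP[xH xS].
have c : #|x |: H| = #|H|.+1 by rewrite cardsU1 xH.
have [||| E [HE ES cE]] := IH (x |: H).
- by rewrite c; lia.
- by rewrite subUset sub1set xS.
- by rewrite c; lia.
by exists E; split=> //; apply: subset_trans HE; apply: subsetUr.
Qed.

(** * Optimal balanced targets *)

Section BalancedTargets.

Variables (I : finType) (v s : I -> nat).
Hypothesis v_le_s : forall i, v i <= s i.

Let p := \sum_i v i.
Let q := p %/ #|I|.
Let r := p %% #|I|.

Lemma sum_mem_card (E : {set I}) : \sum_i (i \in E : nat) = #|E|.
Proof. by rewrite -sum1_card [RHS]big_mkcond; apply: eq_bigr => i _; case: (i \in E). Qed.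

(** A value below [q] forces all others to be at most [q], so the sum is below [q * #|I|]; a value
    above [q.+1] forces all others to be at least [q.+1], and the sum is too large. *)
Lemma balanced_range (t : I -> nat) :
  0 < #|I| -> \sum_i t i = p -> (forall i j, t j <= (t i).+1) ->
  forall i, q <= t i <= q.+1.
Proof.
move=> I0 tp bal i.
have lo : q * #|I| <= p by apply: leq_divM.
have hi : p < q.+1 * #|I| by apply: ltn_ceil.
have Ii : #|I| = #|[pred j | j != i]|.+1.
  rewrite (cardD1 i) inE add1n; congr _.+1.
  by apply: eq_card => j; rewrite !inE andbT.
have cst c : \sum_(j | j != i) c = #|[pred j | j != i]| * c by rewrite sum_nat_const.
apply/andP; split; rewrite leqNgt; apply/negP => lt.
  have : \sum_i t i < q * #|I|.
    rewrite (bigD1 i) //= Ii mulnS -addSn leq_add // mulnC -cst leq_sum // => j _.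
    by have := bal i j; lia.
  by rewrite tp ltnNge lo.
have : q.+1 * #|I| < \sum_i t i.
  rewrite (bigD1 i) //= Ii mulnS -addSn leq_add // mulnC -cst leq_sum // => j _.
  by have := bal j i; lia.
by rewrite tp ltnNge (ltnW hi).
Qed.

(** Balanced targets amount to a set [E] of [r] agents with target [q.+1], inside the set [S] of
    agents with room for it. They save [#|E :&: H|] of the excess over [q]. As [H] lies in [S], the
    largest saving is [minn r #|H|]. *)
Lemma balanced_targets k : 0 < #|I| ->
  (exists t : I -> nat, [/\ forall i, t i <= s i, \sum_i t i = p,
     forall i j, t j <= (t i).+1 & \sum_i (v i - t i) <= k]) <->
  [/\ forall i, q <= s i, #|[set i | s i <= q]| <= #|I| - r
    & \sum_i (v i - q) - minn r #|[set i | q < v i]| <= k].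
Proof.
move=> I0; set H := [set i | q < v i]; pose S := [set i | q < s i].
have HS : H \subset S.
  by apply/subsetP => i; rewrite !inE => h; apply: leq_trans (v_le_s i).
have cS : #|[set i | s i <= q]| = #|I| - #|S|.
  rewrite -(cardsC S) addKn; apply: eq_card => i; by rewrite !inE leqNgt.
have ep : p = #|I| * q + r by rewrite mulnC -divn_eq.
have Sle : #|S| <= #|I| by apply: max_card.
have rlt : r < #|I| by rewrite ltn_mod.
have split_sum (t : I -> nat) (E : {set I}) : (forall i, t i = q + (i \in E)) ->
    \sum_i t i = #|I| * q + #|E| /\
    \sum_i (v i - q) = \sum_i (v i - t i) + #|E :&: H|.
  move=> tE; split.
    by rewrite (eq_bigr _ (fun i _ => tE i)) big_split /= sum_nat_const sum_mem_card.
  rewrite -sum_mem_card -big_split /=; apply: eq_bigr => i _.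
  by rewrite tE !inE; case: (i \in E) => /=; lia.
split=> [[t [ts tp bal tk]]|[qs cs ck]].
  have rg := balanced_range I0 tp bal.
  pose E := [set i | q < t i].
  have tE i : t i = q + (i \in E) by have := rg i; rewrite inE; lia.
  have [s1 s2] := split_sum t E tE.
  have rE : #|E| = r by move: s1; rewrite tp ep; lia.
  split=> [i||].
  - by have := rg i; have := ts i; lia.
  - have ES : E \subset S.
      by apply/subsetP => i; rewrite !inE => h; apply: leq_trans (ts i).
    by rewrite cS; have := subset_leq_card ES; lia.
  have c1 := subset_leq_card (subsetIl E H).
  have c2 := subset_leq_card (subsetIr E H).
  by rewrite s2; lia.
have rS : r <= #|S| by move: cs; rewrite cS; lia.
have [E [ES cE cEH]] : exists E : {set I},
    [/\ E \subset S, #|E| = r & #|E :&: H| = minn r #|H|].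
  (* The saving is largest when [E] lies inside [H], or contains [H] if [H] has fewer than [r]
     elements. *)
  have [rH|Hr] := leqP r #|H|.
    have [|E [_ EH cE]] := subset_of_card (sub0set H) (k := r).
      by rewrite cards0 rH.
    exists E; split=> //; first exact: subset_trans HS.
    by rewrite (setIidPl EH); lia.
  have [|E [HE ES cE]] := subset_of_card HS (k := r); first by rewrite (ltnW Hr).
  exists E; split=> //; rewrite (setIidPr HE); lia.
pose t i := q + (i \in E).
have [s1 s2] := split_sum t E (fun i => erefl).
exists t; split.
- move=> i; rewrite /t; case iE: (i \in E); last by rewrite addn0.
  by move/subsetP: ES => /(_ _ iE); rewrite inE addn1.
- by rewrite s1 cE -ep.
- by move=> i j; rewrite /t; case: (i \in E); case: (j \in E) => /=; lia.
- by move: ck; rewrite -cEH s2 addnK.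
Qed.

End BalancedTargets.

Import GRing.Theory Num.Theory.

(** * EF1 and optimal exchanges for identical binary utilities *)

Section IdenticalBinary.

Local Open Scope ring_scope.

Variables (R : realDomainType) (I : instance R).
Hypotheses (identical : identical_utilities I) (binary : binary_utilities I).
Implicit Types A : allocation (agents I) (goods I).

Let i0 : 'I_(agents I) := Ordinal (ltnW (agents_ge2 I)).

Definition valued_goods : {set 'I_(goods I)} := [set g | utility I i0 [set g] == 1].
Local Notation V := valued_goods.

Lemma utility_card i (S : {set 'I_(goods I)}) : utility I i S = #|S :&: V|%:R.
Proof.
rewrite utility_additive -sum1_card natr_sum [RHS](eq_bigl (fun g => (g \in S) && (g \in V))).
  rewrite big_mkcondr; apply: eq_bigr => g _; rewrite (identical i i0) inE.
  by case: (binary i0 g) => ->; rewrite ?eqxx // eq_sym oner_eq0.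
by move=> g; rewrite inE.
Qed.

(** The best good to remove from a bundle is one of [V], which lowers its value by 1; a bundle
    without such a good has value 0 already. *)
Lemma EF1P A : reflect (forall i j, (worth V A j <= (worth V A i).+1)%N) (EF1 A).
Proof.
apply: (iffP forallP) => [h i j|h i].
  have [->|ij] := eqVneq j i; first exact: leqnSn.
  have /forallP/(_ j)/implyP/(_ ij) := h i.
  case/orP=> [/eqP e|/existsP[g /andP[gj]]]; first by rewrite /worth e set0I cards0.
  rewrite !utility_card ler_nat setIDAC /worth (cardsD1 g (bundle A j :&: V)) => hle.
  by rewrite -add1n leq_add ?leq_b1.
apply/forallP => j; apply/implyP => ji; rewrite /EF1_towards.
have [//|ne] := eqVneq (bundle A j) set0; apply/existsP.
have [|nw] := posnP (worth V A j).
  rewrite /worth; move/eqP; rewrite cards_eq0 => /eqP e.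
  have [g gj] := set0Pn _ ne; exists g; rewrite gj !utility_card ler_nat.
  by rewrite setIDAC e set0D cards0.
have [g gjV] : exists g, g \in bundle A j :&: V by apply/card_gt0P.
have gj : g \in bundle A j by move: gjV; rewrite inE => /andP[].
exists g; rewrite gj !utility_card ler_nat; have := h i j.
by rewrite /worth setIDAC (cardsD1 g (bundle A j :&: V)) gjV.
Qed.

Lemma optimal_number_le A k :
  (exists2 T, is_optimal_number A (Some T) & (T <= k)%N) <->
  (exists2 T, EF1_after A T & (T <= k)%N).
Proof.
split=> [[T [h _] hk]|[T hT hk]]; first by exists T.
(* Sequences of a fixed length form a finite type, so reachability in [T'] exchanges is Boolean and
   a least such number can be taken. *)
pose after T' := [exists s : T'.-tuple (allocation (agents I) (goods I)),
  path (@exchange _ _) A s && EF1 (last A s)].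
have afterP T' : reflect (EF1_after A T') (after T').
  apply: (iffP existsP) => [[s /andP[ps es]]|[s [/eqP hs ps es]]].
    by exists s; split=> //; rewrite size_tuple.
  by exists (Tuple hs); rewrite /= ps es.
have ex : exists T', after T' by exists T; apply/afterP.
case: (ex_minnP ex) => T0 /afterP h0 min; exists T0.
  by split=> // T' /afterP; exact: min.
by apply: leq_trans hk; apply/min/afterP.
Qed.

Lemma optimal_exchangesE A k (n := agents I) (q := (#|V| %/ n)%N) (r := (#|V| %% n)%N) :
  (exists2 T, is_optimal_number A (Some T) & (T <= k)%N) <->
  [/\ forall i, (q <= #|bundle A i|)%N,
      (#|[set i | #|bundle A i| <= q]| <= n - r)%N
    & (\sum_i (worth V A i - q) - minn r #|[set i | q < worth V A i]| <= k)%N].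
Proof.
apply: (iff_trans (optimal_number_le _ _)).
have n0 : (0 < #|'I_n|)%N by rewrite card_ord ltnW // agents_ge2.
have := balanced_targets (worth_le V A) k n0.
rewrite !sum_worth card_ord => h; apply: (iff_trans _ h); split.
  (* The worths reached serve as targets; the excess over them vanishes at the end of the path, so
     its initial value is a lower bound for the length. *)
  case=> T [s [<- ps /EF1P es]] sk; exists (worth V (last A s)).
  have [hc hw] := path_exchange_worth V (worth V (last A s)) ps; split=> //.
  - by move=> i; rewrite -hc; apply: worth_le.
  - by rewrite sum_worth.
  apply: leq_trans sk; apply: leq_trans hw _.
  by rewrite big1 ?addn0 // => i _; rewrite subnn.
case=> t [ts tV bal tk]; have [s [ss ps ws]] := reach_worth ts tV.
exists (size s); last by rewrite ss.
by exists s; split=> //; apply/EF1P => i j; rewrite !ws.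
Qed.

End IdenticalBinary.

(** * Encodings *)

Definition digits (k : nat) : seq bool :=
  [seq odd (k %/ 2 ^ i) | i <- iota 0 (trunc_log 2 k).+1].

Lemma encode_natE k : encode_nat k = [seq Bit d | d <- digits k].
Proof. by rewrite /encode_nat /digits -map_comp. Qed.

Lemma digits_rec k : 1 < k -> digits k = odd k :: digits k./2.
Proof.
move=> k1; rewrite /digits trunc_log2S //; set j := (trunc_log _ _).+1.
rewrite -[iota 0 j.+1]/(0 :: iota (1 + 0) j) map_cons expn0 divn1 iotaDl -map_comp.
congr (_ :: _); apply: eq_map => i /=.
by rewrite add1n expnS divnMA divn2.
Qed.

(** The claim on the last digit strengthens the induction; it is restricted to positive [k] since
    the numeral of 0 ends in 0. *)
Lemma digits_spec k : (0 < k -> last true (digits k)) /\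
  last_digit None (digits k) = Some true /\ bound_value (digits k) = k.
Proof.
have last_digitS b ds : last_digit (Some b) ds = Some (last b ds).
  by rewrite /last_digit; elim: ds b => /=.
have [j] := ubnP k; elim: j k => // j IH k hk.
case: k hk => [|[|k]] hk; [by [] | by [] |].
have [|h1 [h2 h3]] := IH k.+2./2; first lia.
rewrite digits_rec //.
have E : exists d ds, digits k.+2./2 = d :: ds.
  by rewrite /digits /=; do 2 eexists.
case: E h1 h2 h3 => d [ds ->] /= h1 h2 h3.
split; first by move=> _; apply: h1; lia.
split; last by rewrite h3; lia.
by rewrite /last_digit /= -/(last_digit (Some d) ds) last_digitS h1 //; lia.
Qed.

Lemma digits_bound_value ds :
  last_digit None ds = Some true -> digits (bound_value ds) = ds.
Proof.
have last_digitS b es : last_digit (Some b) es = Some (last b es).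
  by rewrite /last_digit; elim: es b => /=.
have canon es : es != [::] -> last true es ->
    0 < bound_value es /\ digits (bound_value es) = es.
  elim: es => // e [|e' es] IH _ hl; first by case: e hl.
  have [||h1 h2] := IH => //; set k := bound_value (e' :: es) in h1 h2 *.
  have -> : bound_value (e :: e' :: es) = e + k.*2 by [].
  split; first lia.
  rewrite digits_rec ?oddD ?odd_double ?addbF ?oddb; last by lia.
  by rewrite half_bit_double h2.
case: ds => // d [|e ds]; first by case: d.
rewrite /last_digit /= -/(last_digit (Some e) ds) last_digitS => -[hl].
have [|h1 h2] := canon (e :: ds) isT; first by [].
set k := bound_value (e :: ds) in h1 h2 *.
rewrite -[LHS]/(digits (d + k.*2)) digits_rec ?oddD ?odd_double ?addbF ?oddb; last by lia.
by rewrite half_bit_double h2.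
Qed.

Lemma encode_rat_bool (b : bool) :
  rcons (encode_rat (b%:R)%R) Comma = utility_item b.
Proof. by case: b. Qed.

Lemma count_mask_map (T : Type) (f h : T -> bool) s :
  count id (mask (map f s) (map h s)) = count (fun x => f x && h x) s.
Proof. by elim: s => //= x s IH; case: (f x) => /=; rewrite IH. Qed.

Lemma count_enum (T : finType) (P : pred T) : count P (enum T) = #|[set x | P x]|.
Proof.
rewrite -sum1_count big_enum_cond -sum1_card; apply: eq_bigl => x.
by rewrite !inE.
Qed.

(** * Instances as Boolean rows *)

Section Rows.

Variables (n m : nat) (A : allocation n m) (V : {set 'I_m}).

Definition utility_bits : seq bool := [seq g \in V | g <- enum 'I_m].

Definition bundle_bits (i : 'I_n) : seq bool := [seq g \in bundle A i | g <- enum 'I_m].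

Definition allocation_bits : seq (seq bool) := [seq bundle_bits i | i <- enum 'I_n].

Lemma count_utility_bits : count id utility_bits = #|V|.
Proof. by rewrite count_map count_enum; apply: eq_card => x; rewrite !inE. Qed.

Lemma count_bundle_bits i : count id (bundle_bits i) = #|bundle A i|.
Proof. by rewrite count_map count_enum; apply: eq_card => x; rewrite !inE. Qed.

Lemma row_value_bits i : row_value utility_bits (bundle_bits i) = worth V A i.
Proof.
by rewrite /row_value count_mask_map count_enum; apply: eq_card => x; rewrite !inE.
Qed.

Lemma sum_allocation_bits g : g < m -> \sum_(bs <- allocation_bits) nth false bs g = 1.
Proof.
move=> hg; rewrite big_map big_enum /=.
have [i gi] := bundle_cover A (Ordinal hg).
rewrite (bigD1 i) //= big1 => [|j ji]; rewrite (nth_map (Ordinal hg)) ?size_enum_ord //.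
all: rewrite (_ : nth _ _ g = Ordinal hg) ?gi //; try by apply: val_inj; rewrite /= nth_enum_ord.
by case gj: (_ \in _) => //; rewrite (bundle_inj gi gj) eqxx in ji.
Qed.

Lemma allocation_bits_conditions q r k :
  [/\ all (fun bs => q <= count id bs) allocation_bits,
      count (fun bs => count id bs <= q) allocation_bits <= n - r
    & \sum_(bs <- allocation_bits) (row_value utility_bits bs - q)
      - minn r (count (fun bs => q < row_value utility_bits bs) allocation_bits) <= k]
  <->
  [/\ forall i, q <= #|bundle A i|, #|[set i | #|bundle A i| <= q]| <= n - r
    & \sum_i (worth V A i - q) - minn r #|[set i | q < worth V A i]| <= k].
Proof.
rewrite !(count_map bundle_bits) !count_enum big_map big_enum all_map /=.
rewrite (eq_bigr (fun i => worth V A i - q)) => [|i _]; last by rewrite row_value_bits.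
have -> : [set x | q < row_value utility_bits (bundle_bits x)] = [set i | q < worth V A i].
  by apply/setP => i; rewrite !inE row_value_bits.
have -> : [set x | count id (bundle_bits x) <= q] = [set i | #|bundle A i| <= q].
  by apply/setP => i; rewrite !inE count_bundle_bits.
split=> -[h1 h2 h3]; split=> //.
  by move=> i; move/allP: h1 => /(_ i); rewrite mem_enum /= count_bundle_bits => ->.
by apply/allP => i _; rewrite /= count_bundle_bits.
Qed.

End Rows.

Lemma utility_rows_encoding (I : instance rat) i :
  identical_utilities I -> binary_utilities I ->
  flatten [seq rcons (encode_rat (utility I i [set g])) Comma
          | g <- enum 'I_(goods I)] ++ [:: Semicolon]
  = utility_row (utility_bits (valued_goods I)).
Proof.
move=> hI hb; rewrite /utility_row /utility_bits -map_comp; congr (flatten _ ++ _).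
apply: eq_map => g /=; rewrite (utility_card hI hb) -encode_rat_bool.
congr (rcons (encode_rat (_%:R)%R) _); case gV: (g \in _).
  by rewrite (setIidPl _) ?cards1 // sub1set.
by apply: eq_card0 => h; rewrite in_setI in_set1; case: eqP => // ->; rewrite gV.
Qed.

Lemma encode_inputE (x : exchange_input) :
  identical_utilities x -> binary_utilities x ->
  encode_input x =
  flatten (nseq (agents x) (utility_row (utility_bits (valued_goods x)))) ++
  Hash :: bundle_rows (allocation_bits (initial x)) ++
  Hash :: [seq Bit d | d <- digits (bound x)].
Proof.
move=> hI hb; rewrite /encode_input encode_natE; congr (flatten _ ++ _ :: flatten _ ++ _).
  rewrite (eq_map (fun i => utility_rows_encoding i hI hb)).
  by rewrite -[in RHS](size_enum_ord (agents x)); elim: (enum _) => //= ? ? ->.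
rewrite /allocation_bits -[RHS]map_comp; apply: eq_map => i /=.
by rewrite /bundle_row /bundle_bits -map_comp.
Qed.

(** * From an accepted word back to an instance *)

Section Decode.

Variables (us : seq bool) (n : nat) (rows : seq (seq bool)).
Hypotheses (us_gt0 : 0 < size us) (n_gt1 : 1 < n) (size_rows : size rows = n).
Hypothesis rows_size : all (fun bs => size bs == size us) rows.
Hypothesis column_sum : forall g, g < size us -> \sum_(bs <- rows) nth false bs g = 1.

Definition decoded_utility (i : 'I_n) (S : {set 'I_(size us)}) : rat :=
  (\sum_(g in S) (nth false us g)%:R)%R.

Lemma decoded_utility1 i g : decoded_utility i [set g] = ((nth false us g)%:R)%R.
Proof. by rewrite /decoded_utility big_set1. Qed.

Lemma decoded_utility_ge0 i S : (0 <= decoded_utility i S)%R.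
Proof. by apply: sumr_ge0 => g _; apply: ler0n. Qed.

Lemma decoded_utility_additive i S :
  decoded_utility i S = (\sum_(g in S) decoded_utility i [set g])%R.
Proof. by apply: eq_bigr => g _; rewrite decoded_utility1. Qed.

Definition decoded_instance : instance rat :=
  Instance n_gt1 us_gt0 decoded_utility_ge0 decoded_utility_additive.

Definition decoded_bundles : {ffun 'I_n -> {set 'I_(size us)}} :=
  [ffun i : 'I_n => [set g : 'I_(size us) | nth false (nth [::] rows i) g]].

Lemma decoded_bundles_allocation : is_allocation decoded_bundles.
Proof.
(* A column sum of 1 gives both that no two bundles share a good and that every good is
   allocated. *)
have col (g : 'I_(size us)) : \sum_(i < n) (g \in decoded_bundles i) = 1.
  rewrite -(column_sum (ltn_ord g)) (big_nth [::]) big_mkord size_rows.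
  by apply: eq_bigr => i _; rewrite ffunE inE.
apply/andP; split.
  apply/forallP => i; apply/forallP => j; apply/implyP => ij.
  rewrite disjoint_subset; apply/subsetP => g gi; rewrite inE; apply/negP => gj.
  have := col g; rewrite (bigD1 i) //= (bigD1 j) 1?eq_sym //= gi gj.
  by rewrite addnA addn1.
apply/eqP/setP => g; rewrite !inE; apply/bigcupP.
have [i gi|none] := pickP [pred i | g \in decoded_bundles i]; first by exists i.
by have := col g; rewrite big1 // => i _; have /= -> := none i.
Qed.

Definition decoded_allocation : allocation n (size us) :=
  exist (fun C => is_allocation C) _ decoded_bundles_allocation.

Lemma utility_bits_decoded : utility_bits (valued_goods decoded_instance) = us.
Proof.
apply: (@eq_from_nth _ false); first by rewrite size_map size_enum_ord.
move=> g; rewrite size_map size_enum_ord => hg.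
rewrite (nth_map (Ordinal hg)) ?size_enum_ord // inE /= decoded_utility1 nth_enum_ord //.
by case: (nth _ _ _); rewrite ?eqxx // eq_sym oner_eq0.
Qed.

Lemma allocation_bits_decoded : allocation_bits decoded_allocation = rows.
Proof.
apply: (@eq_from_nth _ [::]); first by rewrite size_map size_enum_ord.
move=> i; rewrite size_map size_enum_ord => hi.
rewrite (nth_map (Ordinal hi)) ?size_enum_ord //.
have hr : size (nth [::] rows i) = size us.
  by apply/eqP; move/allP: rows_size; apply; rewrite mem_nth // size_rows.
apply: (@eq_from_nth _ false); first by rewrite size_map size_enum_ord.
move=> g; rewrite size_map size_enum_ord => hg.
rewrite (nth_map (Ordinal hg)) ?size_enum_ord // /bundle /= ffunE inE.
by rewrite !nth_enum_ord.
Qed.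

Lemma decoded_binary : binary_utilities decoded_instance.
Proof. by move=> i g /=; rewrite decoded_utility1; case: nth; [right|left]. Qed.

End Decode.

Theorem theorem4p7 :
  in_P (language (restrict
    (fun x : input optimal_exchanges =>
       identical_utilities (the_instance x) /\
       binary_utilities (the_instance x)))).
Proof.
apply: (@stack_machine_in_P symbol (bool * bool)%type mode 12 (ReadUtility None)
  verdict_of delta_of _ 15 2) run_init_halts => w.
apply: (iff_trans (accepts_encodingE w)); split.
  case=> us [n [rows [ds [-> [hus hn] [hr hall] hcol [hl hnum]]]]].
  (* The input decoded from the accepted word has that word as its encoding. *)
  pose x := @ExchangeInput (decoded_instance hus hn)
    (decoded_allocation hr hcol) (bound_value ds).
  have hI : identical_utilities x by [].
  have hb : binary_utilities x by exact: decoded_binary.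
  exists (exist _ x (conj hI hb)); split.
    rewrite /= encode_inputE // utility_bits_decoded allocation_bits_decoded //.
    by rewrite digits_bound_value.
  apply/(optimal_exchangesE hI hb)/allocation_bits_conditions.
  by rewrite -count_utility_bits utility_bits_decoded allocation_bits_decoded //.
case=> -[x [hI hb]] /= [-> hyes].
exists (utility_bits (valued_goods x)), (agents x).
exists (allocation_bits (initial x)), (digits (bound x)).
have [_ [h1 h2]] := digits_spec (bound x).
have sz : size (utility_bits (valued_goods x)) = goods x by rewrite size_map size_enum_ord.
split=> //; first exact: encode_inputE.
- by rewrite sz; split; [apply: goods_ge1 | apply: agents_ge2].
- split; first by rewrite size_map size_enum_ord.
  by apply/allP => bs /mapP[i _ ->]; rewrite sz size_map size_enum_ord.
- by move=> g; rewrite sz; apply: sum_allocation_bits.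
split=> //; rewrite h2 /=.
apply/allocation_bits_conditions; rewrite count_utility_bits.
exact/(optimal_exchangesE hI hb).
Qed.
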